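(* Let $\{t(q_i)\}_{i\ge 1}$ be i.i.d. passage times on the edges of $\mathbb{Z}^d$, $d\ge 2$, such that (i) $\sup_i\mathbb{P}(t(q_i)<\epsilon)\to 0$ as $\epsilon\downarrow 0$, and (ii) $\sup_i\mathbb{E}t^2(q_i)<\infty$. Let $T_n$ be the minimum passage time between the origin and $(n,0,\ldots,0)$. Then there is a constant $\mu_F>0$ such that $$\frac{T_n}{n}\longrightarrow\mu_F\quad\text{almost surely and in }L^2$$ as $n\to\infty$.
   Context: Two vertices of $\mathbb{Z}^d$ are adjacent if their $\ell^1$-distance is $1$, and adjacent vertices are joined by an edge; $\{q_i\}_{i\ge1}$ is an enumeration of all edges. Each edge $q_i$ carries a real random passage time $t(q_i)$, all defined on a common probability space $(\Omega,\mathcal{F},\mathbb{P})$. A path is a finite self-avoiding nearest-neighbour path, viewed as a sequence of distinct edges $\pi=(e_1,\ldots,e_r)$; its passage time is $T(\pi)=\sum_{i=1}^r t(e_i)$. $T_n=\inf_\pi T(\pi)$, the infimum over all finite paths $\pi$ with endvertices the origin and $(n,0,\ldots,0)$. *)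

(* Defs.v *)
From HB Require Import structures.
#[warnings="-notation-overridden,-notation-incompatible-prefix,-ambiguous-paths"]
From mathcomp Require Export all_boot all_order all_algebra finmap.
#[warnings="-notation-overridden,-notation-incompatible-prefix,-ambiguous-paths"]
From mathcomp Require Export all_classical all_reals all_analysis
  measurable_realfun.

Set Implicit Arguments.
Unset Strict Implicit.
Unset Printing Implicit Defensive.
Import Order.TTheory GRing.Theory Num.Theory.
Import numFieldNormedType.Exports.

Local Open Scope classical_set_scope.
Local Open Scope ring_scope.

Section Lattice.
Variable d : nat.

Definition vertex := 'rV[int]_d.

Definition adjacent : rel vertex :=
  fun x y => \sum_(i < d) `|x 0 i - y 0 i| == 1.

Definition is_edge (e : {fset vertex}) : bool :=
  `[< exists x y, adjacent x y /\ e = [fset x; y]%fset >].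

(* Undirected edges, identified with the unordered pair of their endvertices. *)
Definition edge := {e : {fset vertex} | is_edge e}.

(* The sequences of edges traversed by the finite self-avoiding
   nearest-neighbour paths x, p_1, ..., p_r = y; the empty sequence is the path
   of length 0 from x to x. *)
Definition paths (x y : vertex) : set (seq edge) :=
  [set s | exists p : seq vertex,
    [/\ path adjacent x p, uniq (x :: p), last x p = y
      & map val s = pairmap (fun u v => [fset u; v]%fset) x p]].

Definition axis_point (n : nat) : vertex :=
  \row_(i < d) (if i == 0 :> nat then n%:Z else 0).

End Lattice.

Definition passage_time (R : realType) (d : nat) (tau : edge d -> R)
  (s : seq (edge d)) : R := \sum_(e <- s) tau e.

(* The infimum is taken in \bar R: it may be -oo where tau takes negative
   values. *)
Definition min_passage_time (R : realType) (d : nat) (tau : edge d -> R)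
  (n : nat) : \bar R :=
  ereal_inf [set (passage_time tau s)%:E | s in paths 0 (axis_point d n)].

Section Probability.
Context {disp : measure_display} {Omega : measurableType disp} {R : realType}.
Variable P : probability Omega R.

Definition mutually_independent (I : choiceType) (X : I -> {RV P >-> R}) :=
  forall (J : {fset I}) (A : I -> set R), (forall i, measurable (A i)) ->
    P (\bigcap_(i in [set` J]) (X i @^-1` A i)) =
    (\prod_(i <- J) P (X i @^-1` A i))%E.

Definition identically_distributed (I : Type) (X : I -> {RV P >-> R}) :=
  forall (i j : I) (A : set R), measurable A ->
    distribution P (X i) A = distribution P (X j) A.

Definition iid (I : choiceType) (X : I -> {RV P >-> R}) :=
  mutually_independent X /\ identically_distributed X.

Definition cvg_almost_surely (X : nat -> Omega -> \bar R)
  (Y : Omega -> \bar R) :=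
  {ae P, forall w, X n w @[n --> \oo] --> Y w}.

Definition cvg_in_L2 (X : nat -> Omega -> \bar R) (Y : Omega -> \bar R) :=
  (forall n, measurable_fun setT (X n) /\ ('N[P]_2%:E[X n] < +oo)%E) /\
  ('N[P]_2%:E[X n \- Y] @[n --> \oo] -->  0)%E.

End Probability.

(* Main.v *)
Require Import Defs.
From mathcomp Require Import ring lra zify.
Import Order.TTheory GRing.Theory Num.Theory.
Import numFieldNormedType.Exports.

Local Open Scope classical_set_scope.
Local Open Scope ring_scope.


(** Smallness of [P (t < eps)] makes the passage times almost surely positive,
    so they may be replaced by their positive parts. Write [T n] for the
    resulting passage time to [(n, 0, ..., 0)] and [m n] for its mean.

    Existence and positivity of the limit of [m n / n]. Erasing loops gives the
    triangle inequality for passage times ([first_passage_triangle]), and the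
    law of the family is invariant under translation ([mean_translate]), so [m]
    is subadditive and [m n / n] converges by Fekete's lemma. If [eps] is small
    enough, a union bound over walks and over sets of half of their edges shows
    that, with probability at least [1 - 4 ^- r], every self-avoiding path with
    [r] edges starting at the origin has more than half of its edges of passage
    time at least [eps] ([measure_cheap_path]). Hence there is an integrable
    random variable [excess] such that every self-avoiding path [s] from the
    origin satisfies [size s <= T s / (eps / 2) + excess]
    ([path_length_bound]). As a path to [(n, 0, ..., 0)] has at least [n] edges,
    [n <= m n / (eps / 2) + 2], and the limit is positive.

    Variance. Truncate to paths that use finitely many edges, and take two
    independent copies of the passage times. Let [D S] be the mean square of the
    change of the passage time when the coordinates in [S] are taken from the
    second copy. The sum of the squared diagonals of a quadrilateral is at most
    the sum of its squared sides; as exchanging the copies on any set of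
    coordinates preserves the law, this gives
    [D (i |: S) <= D S + D [set i]] ([mix_dist_add]), hence the Efron-Stein
    inequality. Resampling one edge can increase the passage time only if all
    nearly optimal paths use this edge, and then by at most the new value
    ([first_passage_perturb]). Therefore the variance is at most twice the second
    moment of one edge times the mean number of such pivotal edges. They all lie
    on one nearly optimal path, so their mean number is at most linear in [n] by
    [path_length_bound]. Fatou's lemma removes the truncation, and the variance
    of [T n] is [O(n)] ([variance_origin_time]).

    Conclusion. The variance bound gives the convergence of [T n / n] in [L^2]
    at once. Along the squares [n = k ^ 2] the variances of [T n / n] are
    summable, whence almost sure convergence there. Between [k ^ 2] and
    [(k + 1) ^ 2] the passage times differ from those at the endpoints by at most
    the passage time of a segment of the axis with [2 k + 1] edges, which is
    almost surely [o(k ^ 2)] by the same second moment argument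
    ([ae_origin_time]). *)

(** * Paths of the lattice *)

Section LatticePaths.
Set Implicit Arguments.
Unset Strict Implicit.
Variable d : nat.
Implicit Types (x y z u v : vertex d) (p : seq (vertex d)).

(** The unordered pairs of consecutive vertices of the walk [x :: p]. *)
Definition steps x p : seq {fset vertex d} :=
  pairmap (fun u v => [fset u; v]%fset) x p.

(** The edges of the walk [x :: p]; pairs that are not edges are dropped, so this
    lists all the steps only when [x :: p] is a nearest-neighbour walk. *)
Definition edges_along x p : seq (edge d) := pmap insub (steps x p).

Lemma adjacent_edge x y : adjacent x y -> is_edge [fset x; y]%fset.
Proof. by move=> a; apply/asboolP; exists x, y. Qed.

Lemma val_edges_along x p :
  path (@adjacent d) x p -> map val (edges_along x p) = steps x p.
Proof.
rewrite /edges_along; elim: p x => //= y p IH x /andP[a pa].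
case: insubP => [e _ /= ->|/negP[]]; last exact: adjacent_edge.
by rewrite -[in RHS](IH y pa).
Qed.

Lemma size_edges_along x p :
  path (@adjacent d) x p -> size (edges_along x p) = size p.
Proof.
by move=> /val_edges_along /(congr1 size); rewrite size_map size_pairmap.
Qed.

(** A path is determined by its vertices, which turns the existential over edge
    sequences into one over vertex sequences. *)
Lemma pathsP x y (s : seq (edge d)) :
  paths x y s <-> exists p, [/\ path (@adjacent d) x p, uniq (x :: p),
    last x p = y & s = edges_along x p].
Proof.
split=> -[p [pa up lp sp]]; exists p; split => //.
  by apply: (inj_map val_inj); rewrite sp val_edges_along.
by rewrite sp val_edges_along.
Qed.

Lemma steps_sub x p f : f \in steps x p -> {subset f <= x :: p}.
Proof.
elim: p x => //= y p IH x; rewrite /steps/= inE => /orP[/eqP -> z|fin z zf].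
  by rewrite !inE => /orP[->//|->]; rewrite orbT.
by rewrite inE (IH y)// orbT.
Qed.

Lemma paths_uniq x y (s : seq (edge d)) : paths x y s -> uniq s.
Proof.
case=> p [pa up lp sp]; rewrite -(map_inj_uniq val_inj) sp => {s sp y lp}.
elim: p x up {pa} => //= y p IH x /andP[xyp uyp]; rewrite IH// andbT.
apply: contra xyp => /steps_sub; apply; rewrite !inE eqxx//.
Qed.

(** The pair of the [i]-th and [i.+1]-st points of the first axis. *)
Definition axis_step i : {fset vertex d} :=
  [fset axis_point d i; axis_point d i.+1]%fset.

Lemma axis_adjacent i : (0 < d)%N ->
  adjacent (axis_point d i) (axis_point d i.+1).
Proof.
move=> d0; rewrite /adjacent (bigD1 (Ordinal d0))//= big1.
  by rewrite !mxE/= addr0 distrC intS [1 + _]addrC addrAC subrr add0r.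
by move=> j jd; rewrite !mxE (_ : (j == 0 :> nat) = false) ?subrr ?normr0//; exact: negbTE.
Qed.

Lemma axis_point_inj : (0 < d)%N -> injective (axis_point d).
Proof.
move=> d0 i j /rowP/(_ (Ordinal d0)); rewrite !mxE/=.
by move=> [].
Qed.

Lemma axis_paths k n : (0 < d)%N ->
  exists2 s : seq (edge d), paths (axis_point d k) (axis_point d (k + n)) s &
    map val s = [seq axis_step (k + i) | i <- iota 0 n].
Proof.
move=> d0; pose p := [seq axis_point d i | i <- iota k.+1 n].
have pa : path (@adjacent d) (axis_point d k) p.
  rewrite /p; elim: n k {p} => //= n IH k.
  by rewrite axis_adjacent// IH.
exists (edges_along (axis_point d k) p).
  apply/pathsP; exists p; split => //.
    rewrite -[axis_point d k :: p]/(map (axis_point d) (iota k n.+1)).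
    by rewrite map_inj_uniq ?iota_uniq//; exact: axis_point_inj.
  rewrite /p last_map; congr axis_point.
  by rewrite (last_nth 0%N) size_iota -[k :: _]/(iota k n.+1) nth_iota.
rewrite val_edges_along// /p => {pa p}.
elim: n k => //= n IH k; rewrite /steps/= -/(steps _ _) IH addn0; congr cons.
rewrite (iotaDl 1 0 n) -map_comp; apply: eq_map => i /=.
by rewrite add1n addSnnS.
Qed.

Lemma adjacent_coord x y i : adjacent x y -> `|x 0 i - y 0 i| <= 1.
Proof.
move=> /eqP <-; rewrite (bigD1 i)//= lerDl; exact: sumr_ge0.
Qed.

Lemma path_coord x p i : path (@adjacent d) x p ->
  `|x 0 i - last x p 0 i| <= (size p)%:Z.
Proof.
elim: p x => [x _|y p IH x /= /andP[a /IH b]]; first by rewrite subrr.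
rewrite (le_trans (ler_distD (y 0 i) _ _))// intS lerD//.
exact: adjacent_coord.
Qed.

Lemma paths_axis_size n (s : seq (edge d)) : (0 < d)%N ->
  paths 0 (axis_point d n) s -> (n <= size s)%N.
Proof.
move=> d0 /pathsP[p [pa _ lp ->]]; rewrite size_edges_along//.
have := path_coord (Ordinal d0) pa; rewrite lp !mxE/= sub0r normrN.
by rewrite ger0_norm.
Qed.

(** The [2 * d] unit vectors and their opposites. *)
Definition unit_steps : seq (vertex d) :=
  [seq delta_mx 0 i | i <- enum 'I_d] ++ [seq - delta_mx 0 i | i <- enum 'I_d].

Lemma size_unit_steps : size unit_steps = (2 * d)%N.
Proof. by rewrite size_cat !size_map -enumT -cardE card_ord mul2n addnn. Qed.

Lemma adjacent_unit_steps x y : adjacent x y -> y - x \in unit_steps.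
Proof.
move=> a.
have [i xyi] : exists i, x 0 i - y 0 i != 0.
  apply: contrapT => /forallNP h; move: a; rewrite /adjacent big1// => i _.
  by have /negP := h i; rewrite negbK => /eqP ->; rewrite normr0.
have le1 := adjacent_coord i a.
have e1 : `|x 0 i - y 0 i| = 1.
  by apply/eqP; rewrite eq_le le1 -gtz0_ge1 normr_gt0.
have e0 j : j != i -> x 0 j - y 0 j = 0.
  move=> ji; move: a; rewrite /adjacent (bigD1 i)//= e1 -[eqbRHS]addr0 (inj_eq (addrI _)).
  rewrite psumr_eq0// => /allP/(_ j); rewrite mem_index_enum ji/= => /(_ isT).
  by rewrite normr_eq0 => /eqP.
have e (c : int) : x 0 i - y 0 i = c -> y - x = - c *: delta_mx 0 i.
  move=> xc; apply/rowP => k; rewrite !mxE eqxx/=.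
  have [->|/e0 ki] := eqVneq k i; first by rewrite mulr1 -xc opprB.
  by rewrite mulr0 -opprB ki oppr0.
rewrite mem_cat; apply/orP.
move: e1; case: (ger0P (x 0 i - y 0 i)) => _ e1.
  right; rewrite (e 1%R)// scaleNr scale1r; apply: map_f; exact: mem_enum.
left; rewrite (e (-1)%R); last by rewrite -e1 opprK.
by rewrite opprK scale1r; apply: map_f; exact: mem_enum.
Qed.

(** All nearest-neighbour walks with [r] steps from [x], without their starting
    point [x]. *)
Fixpoint walks x r : seq (seq (vertex d)) :=
  if r is r'.+1 then
    [seq x + u :: p | u <- unit_steps, p <- walks (x + u) r']
  else [:: [::]].

Lemma size_walks x r : size (walks x r) = ((2 * d) ^ r)%N.
Proof.
elim: r x => //= r IH x; rewrite size_allpairs_dep sumnE big_map.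
rewrite (eq_bigr (fun _ => (2 * d) ^ r)%N) => [|u _]; last exact: IH.
by rewrite big_const_seq count_predT iter_addn_0 size_unit_steps mulnC expnS.
Qed.

Lemma mem_walks x p : path (@adjacent d) x p -> p \in walks x (size p).
Proof.
elim: p x => //= y p IH x /andP[a /IH pa].
apply/allpairsPdep; exists (y - x), p; split => //.
- exact: adjacent_unit_steps.
- by rewrite addrC subrK.
- by rewrite addrC subrK.
Qed.

Lemma translate_step v x y :
  [fset (u + v)%R | u in [fset x; y]]%fset = [fset (x + v)%R; (y + v)%R]%fset.
Proof.
apply/fsetP => z; rewrite !inE; apply/imfsetP/idP => /=.
  by move=> [u]; rewrite !inE => /orP[]/eqP -> ->; rewrite eqxx ?orbT.
by move=> /orP[]/eqP ->; [exists x|exists y] => //; rewrite !inE eqxx ?orbT.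
Qed.

Lemma translate_subproof v (e : edge d) :
  is_edge [fset (u + v)%R | u in val e]%fset.
Proof.
case: e => f /= /asboolP [x [y [a ->]]]; rewrite translate_step.
apply: adjacent_edge; move: a; rewrite /adjacent => /eqP <-.
by apply/eqP/eq_bigr => i _; rewrite !mxE opprD addrACA subrr addr0.
Qed.

(** The edge [e] shifted by the vector [v]. *)
Definition translate v (e : edge d) : edge d :=
  exist _ [fset (u + v)%R | u in val e]%fset (translate_subproof v e).

Lemma translateK v : cancel (translate v) (translate (- v)).
Proof.
move=> e; apply: val_inj => /=; case: e => f /= /asboolP [x [y [a ->]]].
by rewrite !translate_step !addrK.
Qed.

Lemma translate_inj v : injective (translate v).
Proof. exact: can_inj (translateK v). Qed.

Lemma paths_translate v x y (s : seq (edge d)) :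
  paths x y s -> paths (x + v) (y + v) (map (translate v) s).
Proof.
move=> [p [pa up lp sp]]; exists (map (+%R^~ v) p); split.
- apply: (@homo_path _ _ (+%R^~ v) (@adjacent d) (@adjacent d) x p) => // a b.
  rewrite /adjacent => /eqP <-.
  by apply/eqP/eq_bigr => i _; rewrite !mxE opprD addrACA subrr addr0.
- by move: up; rewrite -(map_inj_uniq (addIr v)).
- by rewrite -lp; exact: (last_map (+%R^~ v)).
- transitivity (map (fun f => [fset (u + v)%R | u in f]%fset) (map val s)).
    by rewrite -!map_comp; apply: eq_map.
  rewrite sp; elim: p x {up pa lp sp} => //= z p IH x.
  by rewrite IH translate_step.
Qed.

Lemma axis_pointD k n : axis_point d (k + n) = axis_point d n + axis_point d k.
Proof.
apply/rowP => i; rewrite !mxE; case: ifP; rewrite ?addr0// => _.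
by rewrite addrC PoszD.
Qed.

Lemma axis_point0 : axis_point d 0 = 0.
Proof. by apply/rowP => i; rewrite !mxE if_same. Qed.

End LatticePaths.

(** * Loop erasure and first passage times *)

Section FirstPassage.
Set Implicit Arguments.
Unset Strict Implicit.
Variables (R : realType) (d : nat).
Implicit Types (tau : edge d -> R) (A : set (seq (edge d))) (s : seq (edge d)).

(** The least passage time over a set [A] of paths, equal to [+oo] if [A] is
    empty. *)
Definition first_passage tau A : \bar R :=
  ereal_inf [set (passage_time tau s)%:E | s in A].

(** The paths of [A] that do not use the edge [e]. *)
Definition avoiding (e : edge d) A : set (seq (edge d)) :=
  [set s | A s /\ e \notin s].

Lemma passage_time_ge0 tau s : (forall e, 0 <= tau e) -> 0 <= passage_time tau s.
Proof. by move=> tau0; rewrite /passage_time sumr_ge0. Qed.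

Lemma first_passage_ge0 tau A :
  (forall e, 0 <= tau e) -> (0 <= first_passage tau A)%E.
Proof.
move=> tau0; apply: le_ereal_inf_tmp => _ [s _ <-].
by rewrite lee_fin passage_time_ge0.
Qed.

Lemma first_passage_le tau A s :
  A s -> (first_passage tau A <= (passage_time tau s)%:E)%E.
Proof. by move=> As; apply: ereal_inf_lbound; exists s. Qed.

Lemma first_passage_fin tau A : (forall e, 0 <= tau e) -> A !=set0 ->
  first_passage tau A \is a fin_num.
Proof.
move=> tau0 [s As]; rewrite ge0_fin_numE ?first_passage_ge0//.
by rewrite (le_lt_trans (first_passage_le tau As))// ltry.
Qed.

Lemma first_passageE tau A : (forall e, 0 <= tau e) -> A !=set0 ->
  first_passage tau A = (fine (first_passage tau A))%:E.
Proof. by move=> *; rewrite fineK// first_passage_fin. Qed.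

Lemma fine_first_passage_ge0 tau A :
  (forall e, 0 <= tau e) -> 0 <= fine (first_passage tau A).
Proof. by move=> *; rewrite fine_ge0// first_passage_ge0. Qed.

Lemma first_passage_lt tau A (c : \bar R) : (first_passage tau A < c)%E ->
  exists2 s, A s & ((passage_time tau s)%:E < c)%E.
Proof. by move=> /ereal_inf_lt[_ [s As <-] ?]; exists s. Qed.

Lemma passage_time_steps tau s :
  passage_time tau s = \sum_(f <- map val s)
    (if insub f is Some e then tau (e : edge d) else 0).
Proof.
rewrite /passage_time big_map; apply: eq_bigr => e _.
by rewrite valK.
Qed.

(** Erasing the loops of a walk yields a self-avoiding path along a subset of
    its edges. *)
Lemma loop_erasure tau x (p : seq (vertex d)) : (forall e, 0 <= tau e) ->
  path (@adjacent d) x p -> exists2 s, paths x (last x p) s &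
    passage_time tau s <= passage_time tau (edges_along x p).
Proof.
move=> tau0 pa.
pose g f := if insub f is Some e then tau (e : edge d) else 0.
have g0 f : 0 <= g f by rewrite /g; case: insub.
suff [p' [pa' up' lp' le]] : exists p', [/\ path (@adjacent d) x p',
    uniq (x :: p'), last x p' = last x p &
    \sum_(f <- steps x p') g f <= \sum_(f <- steps x p) g f].
  exists (edges_along x p'); first by apply/pathsP; exists p'.
  by rewrite !passage_time_steps !val_edges_along.
(* The erased tail [p'] is kept if it avoids [x]; otherwise it is cut at the
   visit to [x], and the loop before this visit is discarded. *)
elim: p x pa => [x _|y p IH x /= /andP[a /IH[p' [pa' up' lp' le]]]].
  by exists [::].
have [xin|xnin] := boolP (x \in y :: p'); last first.
  exists (y :: p'); split.
  - by rewrite /= a.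
  - by rewrite cons_uniq xnin.
  - by [].
  - by rewrite /steps /= !big_cons lerD2l.
have step0 : \sum_(f <- steps y p) g f <= \sum_(f <- steps x (y :: p)) g f.
  by rewrite /= big_cons lerDr.
move: xin; rewrite inE => /predU1P[xy|xin].
  by exists p'; rewrite xy in step0 *; split=> //; exact: le_trans step0.
case/splitPr: xin pa' up' lp' le => p1 p2.
rewrite cat_path last_cat /= => /and3P[_ _ pa2].
rewrite cat_uniq /= => /and4P[_ _ _ /andP[xp2 up2]] lp2 le.
exists p2; rewrite /= xp2 up2; split=> //.
apply: le_trans step0; apply: le_trans le.
by rewrite /steps pairmap_cat big_cat/= big_cons addrA lerDr addr_ge0// sumr_ge0.
Qed.

Lemma passage_time_cat tau s1 s2 :
  passage_time tau (s1 ++ s2) = passage_time tau s1 + passage_time tau s2.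
Proof. by rewrite /passage_time big_cat. Qed.

Lemma edges_along_cat (x : vertex d) p1 p2 :
  edges_along x (p1 ++ p2) = edges_along x p1 ++ edges_along (last x p1) p2.
Proof. by rewrite /edges_along /steps pairmap_cat pmap_cat. Qed.

Lemma first_passage_triangle tau (x y z : vertex d) : (forall e, 0 <= tau e) ->
  (first_passage tau (paths x z) <=
   first_passage tau (paths x y) + first_passage tau (paths y z))%E.
Proof.
move=> tau0.
have H s1 s2 : paths x y s1 -> paths y z s2 ->
    (first_passage tau (paths x z) <=
     (passage_time tau s1)%:E + (passage_time tau s2)%:E)%E.
  move=> /pathsP[p1 [pa1 _ l1 ->]] /pathsP[p2 [pa2 _ l2 ->]].
  have [|s] := @loop_erasure tau x (p1 ++ p2) tau0.
    by rewrite cat_path pa1 l1.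
  rewrite last_cat l1 edges_along_cat l1 passage_time_cat l2 => ps le.
  by rewrite (le_trans (first_passage_le tau ps))// lee_fin.
have ninf A : first_passage tau A != -oo%E.
  by rewrite gt_eqF// (lt_le_trans _ (first_passage_ge0 A tau0))// ltNyr.
have [E1|N1] := eqVneq (first_passage tau (paths x y)) +oo%E.
  by rewrite E1 addye ?leey.
have [E2|N2] := eqVneq (first_passage tau (paths y z)) +oo%E.
  by rewrite E2 addey ?leey.
have F1 : first_passage tau (paths x y) \is a fin_num.
  by rewrite fin_numE N1 ninf.
have F2 : first_passage tau (paths y z) \is a fin_num.
  by rewrite fin_numE N2 ninf.
rewrite -leeBlDr//; apply: le_ereal_inf_tmp => _ [s1 As1 <-].
rewrite leeBlDr// addeC -leeBlDr//; apply: le_ereal_inf_tmp => _ [s2 As2 <-].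
by rewrite leeBlDr// addeC; exact: H.
Qed.

Lemma passage_time_map tau (h : edge d -> edge d) s :
  passage_time tau (map h s) = passage_time (tau \o h) s.
Proof. by rewrite /passage_time big_map. Qed.

Lemma first_passage_translate tau (v x y : vertex d) :
  first_passage tau (paths (x + v) (y + v)) =
  first_passage (tau \o translate v) (paths x y).
Proof.
congr ereal_inf; apply/seteqP; split=> _ [s As <-].
  exists (map (translate (- v)) s).
    by have := paths_translate (- v) As; rewrite !addrK.
  rewrite -passage_time_map -map_comp map_id_in// => e _.
  by rewrite /= -[v in translate v]opprK translateK.
by exists (map (translate v) s); [exact: paths_translate|rewrite passage_time_map].
Qed.

(** Changing the passage time of the single edge [e] to [tau' e] costs at most
    [tau' e], and costs nothing unless every nearly optimal path traverses [e]. *)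
Lemma first_passage_perturb tau tau' (e : edge d) A :
  (forall f, 0 <= tau f) -> (forall f, 0 <= tau' f) ->
  (forall f, f != e -> tau' f = tau f) -> (forall s, A s -> uniq s) ->
  A !=set0 ->
  fine (first_passage tau' A) - fine (first_passage tau A) <=
  tau' e * (first_passage tau A < first_passage tau (avoiding e A))%E%:R.
Proof.
move=> tau0 tau'0 tt' uA A0.
have agree s : e \notin s -> passage_time tau' s = passage_time tau s.
  move=> es; apply: eq_big_seq => f fs; apply: tt'.
  by apply: contraNneq es => <-.
case: ltP => h; rewrite ?mulr1 ?mulr0.
  rewrite lerBlDl -lee_fin EFinD -!first_passageE// -leeBlDr//.
  apply: le_ereal_inf_tmp => _ [s As <-]; rewrite leeBlDr// -EFinD.
  rewrite (le_trans (first_passage_le tau' As))// lee_fin.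
  have [es|es] := boolP (e \in s); last by rewrite agree// lerDl.
  rewrite /passage_time !(big_rem e es)/= [leLHS]addrC lerD2r.
  rewrite [leLHS](_ : _ = passage_time tau (rem e s)) ?lerDr//.
  by apply: agree; rewrite mem_rem_uniqF// uA.
rewrite subr_le0 -lee_fin -!first_passageE// (le_trans _ h)//.
apply: le_ereal_inf_tmp => _ [s [As es] <-].
by rewrite -agree// first_passage_le.
Qed.

(** Edges that every nearly optimal path must traverse are no more numerous
    than the edges of one nearly optimal path; [len] bounds the latter in terms
    of the passage time. The summand [1] pays for the path being only nearly
    optimal. *)
Lemma pivotal_count tau A (I : seq (edge d)) (a L : R) :
  (forall f, 0 <= tau f) -> A !=set0 -> 0 < a -> uniq I ->
  (forall s, A s -> (size s)%:R <= passage_time tau s / a + L) ->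
  {in I, forall e, (first_passage tau A < first_passage tau (avoiding e A))%E} ->
  (size I)%:R <= fine (first_passage tau A) / a + 1 + L.
Proof.
move=> tau0 A0 a0 uI len piv.
(* A path cheaper than [c] uses every edge of [I] and is optimal up to [a]. *)
pose c := \big[mine/(first_passage tau A + a%:E)%E]_(e <- I)
  first_passage tau (avoiding e A).
have /first_passage_lt[s As sc] : (first_passage tau A < c)%E.
  rewrite /c; elim: I piv {uI c} => [_|e I IH piv].
    by rewrite big_nil lteDl ?first_passage_fin ?lte_fin.
  rewrite big_cons lt_min piv ?mem_head//= IH// => f fI.
  by apply: piv; rewrite inE fI orbT.
have cle : (c <= first_passage tau A + a%:E)%E.
  rewrite /c; elim: (I) => [|e J IH]; first by rewrite big_nil.
  by rewrite big_cons ge_min IH orbT.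
have IS : {subset I <= s}.
  move=> e eI; apply/negPn/negP => es.
  have ce : (c <= first_passage tau (avoiding e A))%E.
    rewrite /c; elim: (I) eI => // f J IH; rewrite inE big_cons ge_min.
    by move=> /predU1P[->|/IH ->]; rewrite ?lexx ?orbT.
  have : ((passage_time tau s)%:E < (passage_time tau s)%:E)%E.
    rewrite (lt_le_trans sc)// (le_trans ce)//.
    by apply: first_passage_le.
  by rewrite ltxx.
have sI : ((size I)%:R <= (size s)%:R :> R).
  by rewrite ler_nat uniq_leq_size.
rewrite (le_trans sI)// (le_trans (len _ As))// lerD2r.
rewrite -[1](divff (lt0r_neq0 a0)) -mulrDl ler_pM2r ?invr_gt0//.
rewrite -lee_fin EFinD -first_passageE//; apply: (le_trans (ltW sc)).
exact: cle.
Qed.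

(** First passage times over sets that exhaust [A] converge to that over [A]. *)
Lemma first_passage_exhaust tau A (An : nat -> set (seq (edge d))) :
  (forall f, 0 <= tau f) -> A !=set0 -> (forall N, An N `<=` A) ->
  (forall s, A s -> exists N0, forall N, (N0 <= N)%N -> An N s) ->
  fine (first_passage tau (An N)) @[N --> \oo] --> fine (first_passage tau A).
Proof.
move=> tau0 A0 AnA An_ex; apply/cvgrPdist_lt => e e0.
have [s As sc] : exists2 s, A s &
    passage_time tau s < fine (first_passage tau A) + e.
  have : (first_passage tau A < first_passage tau A + e%:E)%E.
    by rewrite lteDl ?first_passage_fin ?lte_fin.
  move=> /first_passage_lt[s As]; rewrite [X in (_ < X + _)%E]first_passageE//.
  by rewrite -EFinD lte_fin => ?; exists s.
have [N0 N0P] := An_ex s As; near=> N.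
have ANs : An N s by apply: N0P; near: N; exact: nbhs_infty_ge.
have AN0 : An N !=set0 by exists s.
have le1 : fine (first_passage tau A) <= fine (first_passage tau (An N)).
  rewrite -lee_fin -!first_passageE//; apply: ereal_inf_le_tmp.
  by move=> _ [u Au <-]; exists u => //; apply: (AnA N).
rewrite distrC ger0_norm ?subr_ge0// ltrBlDl (le_lt_trans _ sc)//.
by rewrite -lee_fin -first_passageE// first_passage_le.
Unshelve. all: by end_near. Qed.

Lemma axis_edge_subproof i : (0 < d)%N -> is_edge (axis_step d i).
Proof. by move=> d0; exact/adjacent_edge/axis_adjacent. Qed.

(** The [i]-th edge of the first axis. *)
Definition axis_edge (d0 : (0 < d)%N) i : edge d :=
  exist _ (axis_step d i) (axis_edge_subproof i d0).

Lemma axis_edges_paths (d0 : (0 < d)%N) k n :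
  paths (axis_point d k) (axis_point d (k + n)) (map (axis_edge d0) (iota k n)).
Proof.
have [s ps vs] := axis_paths k n d0.
suff <- : s = map (axis_edge d0) (iota k n) by [].
apply: (inj_map val_inj); rewrite vs -map_comp -{2}[k]addn0 iotaDl -map_comp.
exact: eq_map.
Qed.

Lemma first_passage_axis (d0 : (0 < d)%N) tau k n :
  (first_passage tau (paths (axis_point d k) (axis_point d (k + n))) <=
   (\sum_(i <- iota k n) tau (axis_edge d0 i))%:E)%E.
Proof.
by have := first_passage_le tau (axis_edges_paths d0 k n); rewrite /passage_time big_map.
Qed.

End FirstPassage.

(** * Families of independent variables with a common law *)

Section ProductLaw.
Set Implicit Arguments.
Unset Strict Implicit.
Local Open Scope ereal_scope.
Variables (R : realType) (J : choiceType).

(** Sets of configurations [J -> R] defined by measurable constraints on finitely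
    many coordinates; they generate the product sigma-algebra, with which the
    type [config] below is equipped. *)
Definition cylinders : set (set (J -> R)) :=
  [set C | exists (s : seq J) (A : J -> set R), (forall j, measurable (A j)) /\
    C = [set x | forall j, j \in s -> A j (x j)]].

Local Notation config := (g_sigma_algebraType cylinders).

Lemma measurable_coord (j : J) : measurable_fun setT (fun x : config => (x : J -> R) j).
Proof.
move=> _ B mB; rewrite setTI; apply: sub_sigma_algebra.
exists [:: j], (fun=> B); split=> //; apply/seteqP; split=> x /=.
  by move=> Bx k; rewrite inE => /eqP ->.
by apply; rewrite inE.
Qed.

Lemma measurable_config d (T : measurableType d) (Y : T -> config) :
  (forall j : J, measurable_fun setT (fun w => (Y w : J -> R) j)) ->
  measurable_fun setT Y.
Proof.
move=> mY; apply: (@measurability _ _ _ _ setT Y cylinders) => //.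
move=> _ [_ [s [A [mA ->]] <-]]; rewrite setTI.
rewrite (_ : _ @^-1` _ = \bigcap_(j in [set` s]) ((fun w => (Y w : J -> R) j) @^-1` A j)).
  by apply: fin_bigcap_measurable => // j _; rewrite -[X in measurable X]setTI; exact: mY.
by apply/seteqP; split=> w /=.
Qed.

Lemma cylinders_setI : setI_closed cylinders.
Proof.
move=> _ _ [s1 [A1 [mA1 ->]]] [s2 [A2 [mA2 ->]]].
exists (s1 ++ s2), (fun j => (if j \in s1 then A1 j else setT) `&`
                             (if j \in s2 then A2 j else setT)).
split; first by move=> j; apply: measurableI; case: ifP.
apply/seteqP; split=> x /=.
  move=> [h1 h2] j _; split; case: ifP => //; [exact: h1|exact: h2].
move=> h; split=> j js.
  by have := h j; rewrite mem_cat js => /(_ isT)[].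
by have := h j; rewrite mem_cat js orbT => /(_ isT)[_].
Qed.

(** [Y] is an independent family of measurable functions with common law [nu].
    The law is an arbitrary set function, so that it can be read off one variable
    of the family. *)
Definition product_law d (T : measurableType d) (P : probability T R)
    (Y : J -> T -> R) (nu : set R -> \bar R) :=
  (forall j, measurable_fun setT (Y j)) /\
  forall (s : seq J) (A : J -> set R), uniq s -> (forall j, measurable (A j)) ->
    P [set w | forall j, j \in s -> A j (Y j w)] = \prod_(j <- s) nu (A j).

Lemma product_law_config d (T : measurableType d) (P : probability T R)
    (Y : J -> T -> R) (nu : set R -> \bar R) : product_law P Y nu ->
  measurable_fun setT ((fun w j => Y j w) : T -> config).
Proof. by move=> [mY _]; apply: measurable_config. Qed.

(** Two such families have the same law on configurations, because the
    cylinders form a pi-system. *)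
Lemma product_law_integral d1 d2 (T1 : measurableType d1) (T2 : measurableType d2)
    (P1 : probability T1 R) (P2 : probability T2 R)
    (Y1 : J -> T1 -> R) (Y2 : J -> T2 -> R) (nu : set R -> \bar R)
    (G : config -> \bar R) :
  product_law P1 Y1 nu -> product_law P2 Y2 nu ->
  measurable_fun setT G -> (forall x, 0 <= G x) ->
  \int[P1]_w G (fun j => Y1 j w) = \int[P2]_w G (fun j => Y2 j w).
Proof.
move=> l1 l2 mG G0.
have m1 := product_law_config l1; have m2 := product_law_config l2.
have G0' : {in [set: config], forall y, 0 <= G y} by move=> y _.
have /esym e1 := ge0_integral_pushforward m1 P1 measurableT mG G0'.
have /esym e2 := ge0_integral_pushforward m2 P2 measurableT mG G0'.
rewrite !preimage_setT in e1 e2; rewrite [LHS]e1 [RHS]e2.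
apply: eq_measure_integral => A mA _.
apply: (@measure_unique _ R config cylinders (fun=> setT)) => //.
- exact: cylinders_setI.
- by move=> _; exists [::], (fun=> setT); split=> //; apply/seteqP; split.
- by rewrite bigcup_const.
- move=> _ [s [B [mB ->]]]; rewrite /= /pushforward.
  have E x : (forall j, j \in s -> B j (x j)) <-> (forall j, j \in undup s -> B j (x j)).
    by split=> h j; have := h j; rewrite mem_undup.
  have {E}-> : [set x : J -> R | forall j, j \in s -> B j (x j)] =
      [set x | forall j, j \in undup s -> B j (x j)].
    by apply/seteqP; split=> x /E.
  by rewrite /preimage/= (l1.2 _ _ (undup_uniq s) mB) (l2.2 _ _ (undup_uniq s) mB).
- by move=> _; rewrite /= /pushforward preimage_setT probability_setT ltry.
Qed.


End ProductLaw.

(** * The Efron-Stein inequality *)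

(** Configurations with the product sigma-algebra. *)
Notation config J R := (g_sigma_algebraType (@cylinders R J)).

Section EfronStein.
Set Implicit Arguments.
Unset Strict Implicit.
Local Open Scope ereal_scope.
Variables (R : realType) (J : choiceType) (disp : measure_display)
  (T : measurableType disp) (P : probability T R)
  (X : J -> T -> R) (nu : set R -> \bar R).
Hypothesis lawX : product_law P X nu.

Let mX j : measurable_fun setT (X j). Proof. exact: lawX.1. Qed.

(** Two independent copies of the family [X]: the coordinate [(j, b)] is [X j] at
    the first point of [T * T] if [b] is false, and at the second otherwise. *)
Definition doubled (jb : J * bool) (w : T * T) : R :=
  X jb.1 (if jb.2 then w.2 else w.1).

Lemma measurable_doubled jb : measurable_fun setT (doubled jb).
Proof.
case: jb => j [] /=; apply: (measurableT_comp (mX j)).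
  exact: measurable_snd.
exact: measurable_fst.
Qed.

Lemma measurable_finite_event (Y : J -> T -> R) (s : seq J) (A : J -> set R) :
  (forall j, measurable_fun setT (Y j)) -> (forall j, measurable (A j)) ->
  measurable [set w | forall j, j \in s -> A j (Y j w)].
Proof.
move=> mY mA.
rewrite (_ : mkset _ = \bigcap_(j in [set` s]) (Y j @^-1` A j)).
  by apply: fin_bigcap_measurable => // j _; rewrite -[X in measurable X]setTI; exact: mY.
by apply/seteqP; split=> w /=.
Qed.

Lemma product_law_doubled : product_law (P \x P) doubled nu.
Proof.
split=> [|s A us mA]; first exact: measurable_doubled.
pose sb b := [seq x.1 | x <- s & x.2 == b].
pose E b := [set w | forall j, j \in sb b -> A (j, b) (X j w)].
have jsb j b : (j \in sb b) = ((j, b) \in s).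
  apply/mapP/idP => [[[k c]]|jbs].
    by rewrite mem_filter /= => /andP[/eqP -> ? ->].
  by exists (j, b) => //; rewrite mem_filter /= eqxx.
have usb b : uniq (sb b).
  rewrite map_inj_in_uniq ?filter_uniq// => -[j b1] [k b2].
  by rewrite !mem_filter /= => /andP[/eqP -> _] /andP[/eqP -> _] ->.
have -> : [set w | forall jb, jb \in s -> A jb (doubled jb w)] = E false `*` E true.
  apply/seteqP; split=> [[w1 w2] /= h|[w1 w2] [/= h1 h2] [j b] js].
    by split=> /= j; rewrite jsb => /h.
  by case: b js => js; rewrite /doubled/=; [apply: h2|apply: h1]; rewrite jsb.
have mE b : measurable (E b) by exact: (@measurable_finite_event X (sb b) (fun j => A (j, b))).
have PE b : P (E b) = \prod_(x <- s | x.2 == b) nu (A x).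
  rewrite /E (lawX.2 _ (fun j => A (j, b)) (usb b))// /sb big_map big_filter.
  by apply: eq_bigr => -[j c] /= /eqP ->.
transitivity (P (E false) * P (E true)); first exact: product_measure1E.
rewrite !PE.
rewrite [RHS](bigID (fun x => x.2 == false))/=; congr (_ * _).
by apply: eq_bigl => -[j []].
Qed.

(** The configuration that takes its coordinates in [S] from the second copy
    and the others from the first. *)
Definition mix (S : pred J) (w : T * T) : config J R := fun j => doubled (j, S j) w.

Lemma measurable_mix S : measurable_fun setT (mix S).
Proof. by apply: measurable_config => j; exact: measurable_doubled. Qed.

Variable f : config J R -> R.
Hypothesis mf : measurable_fun setT f.

(** The mean of [phi] at the difference of the values of [f] on two mixtures. *)
Definition mix_dist (phi : R -> R) (S1 S2 : pred J) : \bar R :=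
  \int[P \x P]_w (phi (f (mix S1 w) - f (mix S2 w))%R)%:E.

Lemma eq_mix_dist phi S1 S1' S2 S2' : S1 =1 S1' -> S2 =1 S2' ->
  mix_dist phi S1 S2 = mix_dist phi S1' S2'.
Proof. by move=> /funext -> /funext ->. Qed.

(** Exchanging the two copies on the coordinates in [S] preserves the law. *)
Lemma mix_dist_swap (phi : R -> R) (S S1 S2 : pred J) : measurable_fun setT phi ->
  (forall x, (0 <= phi x)%R) ->
  mix_dist phi S1 S2 =
  mix_dist phi (fun j => S1 j (+) S j) (fun j => S2 j (+) S j).
Proof.
move=> mphi phi0.
pose restr (S0 : pred J) (z : config (J * bool)%type R) : config J R :=
  fun j => (z : J * bool -> R) (j, S0 j).
have mrestr S0 : measurable_fun setT (restr S0).
  by apply: measurable_config => j; exact: measurable_coord.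
pose G z := (phi (f (restr S1 z) - f (restr S2 z))%R)%:E.
have mG : measurable_fun setT G.
  apply/measurable_EFinP; apply: (measurableT_comp mphi).
  by apply: measurable_funB; exact: measurableT_comp.
have G0 z : 0 <= G z by rewrite lee_fin.
pose sw (jb : J * bool) := (jb.1, jb.2 (+) S jb.1).
have swI : injective sw.
  by move=> [j b] [k c] [-> /= /addIb ->].
have law1 := product_law_doubled.
have law2 : product_law (P \x P) (fun jb w => doubled (sw jb) w) nu.
  split=> [jb|s A us mA]; first exact: measurable_doubled.
  pose A' jb := A (sw jb).
  have swK jb : sw (sw jb) = jb by case: jb => j b; rewrite /sw/= -addbA addbb addbF.
  rewrite (_ : mkset _ = [set w | forall jb, jb \in map sw s -> A' jb (doubled jb w)]).
    rewrite law1.2 ?map_inj_uniq//; last by move=> jb; exact: mA.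
    by rewrite big_map; apply: eq_bigr => jb _; rewrite /A' swK.
  apply/seteqP; split=> w /= h jb.
    by move=> /mapP[k ks ->]; rewrite /A' swK; exact: h.
  by move=> js; rewrite -[jb in A jb]swK; apply: h; exact: map_f.
exact: (product_law_integral law1 law2 mG G0).
Qed.

Lemma measurable_mix_dist (phi : R -> R) (S1 S2 : pred J) : measurable_fun setT phi ->
  measurable_fun setT (fun w => (phi (f (mix S1 w) - f (mix S2 w))%R)%:E).
Proof.
move=> mphi; apply/measurable_EFinP; apply: (measurableT_comp mphi).
by apply: measurable_funB; apply: measurableT_comp => //; exact: measurable_mix.
Qed.

Let sq (x : R) : R := (x ^+ 2)%R.
Let msq : measurable_fun setT sq. Proof. exact: exprn_measurable. Qed.
Let sq0 x : (0 <= sq x)%R. Proof. exact: sqr_ge0. Qed.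

(** The squared diagonals of a quadrilateral against its squared sides; the two
    members differ by the square of [a - b - c + e]. *)
Lemma quadrilateral (a b c e : R) :
  (sq (a - e) + sq (b - c) <=
   sq (a - b) + sq (c - e) + (sq (a - c) + sq (b - e)))%R.
Proof.
rewrite -subr_ge0 [leRHS](_ : _ = sq (a - b - c + e)) ?sq0//.
by rewrite /sq; ring.
Qed.

(** The quadrilateral has vertices [f] at the mixtures over the empty set, [S],
    [[set i]] and [i |: S]. By exchangeability both diagonals have the same mean
    square, as have opposite sides. *)
Lemma mix_dist_add (S : pred J) i : ~~ S i ->
  mix_dist sq pred0 (predU (pred1 i) S) <=
  mix_dist sq pred0 S + mix_dist sq pred0 (pred1 i).
Proof.
move=> Si; set D := mix_dist sq pred0.
have D0 S' : 0 <= D S' by apply: integral_ge0 => w _; rewrite lee_fin.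
have swap S' S1 S2 S3 : (forall j, S1 j (+) S' j = false) ->
    (forall j, S2 j (+) S' j = S3 j) -> mix_dist sq S1 S2 = D S3.
  by move=> h1 h2; rewrite (mix_dist_swap S' S1 S2)//; exact: eq_mix_dist.
have Q1 : mix_dist sq S (pred1 i) = D (predU (pred1 i) S).
  apply: (swap S) => j /=; first exact: addbb.
  by have [->|] := eqVneq j i; rewrite ?(negbTE Si).
have Q2 : mix_dist sq (pred1 i) (predU (pred1 i) S) = D S.
  apply: (swap (pred1 i)) => j /=; first exact: addbb.
  by have [->|] := eqVneq j i; rewrite ?(negbTE Si)// addbF.
have Q3 : mix_dist sq S (predU (pred1 i) S) = D (pred1 i).
  apply: (swap S) => j /=; first exact: addbb.
  by have [->|] := eqVneq j i; rewrite ?(negbTE Si)//= addbb.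
have m S1 S2 := measurable_mix_dist S1 S2 msq.
have g S1 S2 (w : T * T) : [set: T * T] w -> 0 <= (sq (f (mix S1 w) - f (mix S2 w))%R)%:E.
  by move=> _; rewrite lee_fin.
have : D (predU (pred1 i) S) + mix_dist sq S (pred1 i) <=
    D S + mix_dist sq (pred1 i) (predU (pred1 i) S) +
    (D (pred1 i) + mix_dist sq S (predU (pred1 i) S)).
  rewrite /D /mix_dist -!ge0_integralD//; try exact: g; try exact: m.
  - apply: ge0_le_integral => //.
    + by move=> w _; rewrite adde_ge0 ?lee_fin.
    + by apply: emeasurable_funD; exact: m.
    + by apply: emeasurable_funD; apply: emeasurable_funD; exact: m.
    + by move=> w _; rewrite -!EFinD lee_fin quadrilateral.
  - by move=> w _; rewrite adde_ge0 ?lee_fin.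
  - by apply: emeasurable_funD; exact: m.
  - by move=> w _; rewrite adde_ge0 ?lee_fin.
  - by apply: emeasurable_funD; exact: m.
rewrite Q1 Q2 Q3 => {Q1 Q2 Q3 swap}.
move: (D _) (D _) (D _) => x y z h.
rewrite leNgt; apply/negP => hlt.
by have := lteD hlt hlt; rewrite addeACA ltNge h.
Qed.

Lemma mix_dist_seq (s : seq J) : uniq s ->
  mix_dist sq pred0 (mem s) <= \sum_(i <- s) mix_dist sq pred0 (pred1 i).
Proof.
elim: s => [_|i s IH /= /andP[si us]].
  rewrite big_nil /mix_dist integral0_eq// => w _.
  rewrite (_ : mix (mem [::]) w = mix pred0 w) ?subrr /sq ?expr0n//.
rewrite big_cons addeC -(@eq_mix_dist _ pred0 _ (predU (pred1 i) (mem s)))//.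
  by apply: le_trans (leeD2r _ (IH us)); exact: mix_dist_add.
Qed.

Let psq (x : R) : R := (Num.max 0 x ^+ 2)%R.
Let mpsq : measurable_fun setT psq.
Proof.
apply: (measurableT_comp (f := fun x : R => x ^+ 2)%R) => //.
exact: measurable_maxr.
Qed.
Let psq0 x : (0 <= psq x)%R. Proof. exact: sqr_ge0. Qed.

Let psq_bound (z a : R) (b : bool) :
  (z <= Num.max 0 a * b%:R)%R -> (psq z <= b%:R * a ^+ 2)%R.
Proof.
rewrite /psq; case: b; rewrite ?mulr0 ?mulr1 ?mul0r ?mul1r => h.
  rewrite -[leRHS](real_normK (num_real a)) lerXn2r ?nnegrE//.
    by rewrite le_max lexx.
  by rewrite ge_max normr_ge0 (le_trans h)// ge_max normr_ge0 ler_norm.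
by rewrite max_l// expr0n.
Qed.

(** By exchangeability the positive and the negative part of the difference have
    the same mean square. *)
Lemma mix_dist_one_sided i : mix_dist sq pred0 (pred1 i) =
  mix_dist psq (pred1 i) pred0 + mix_dist psq (pred1 i) pred0.
Proof.
have {1}-> : mix_dist psq (pred1 i) pred0 = mix_dist psq pred0 (pred1 i).
  rewrite (mix_dist_swap (pred1 i))//; apply: eq_mix_dist => // j /=; exact: addbb.
rewrite /mix_dist -ge0_integralD//; try exact: measurable_mix_dist.
  apply: eq_integral => w _; rewrite -EFinD; congr EFin.
  set x := f _; set y := f _; rewrite /sq /psq.
  have [xy|/ltW xy] := leP x y.
    have /max_l -> : (x - y <= 0)%R by rewrite subr_le0.
    have /max_r -> : (0 <= y - x)%R by rewrite subr_ge0.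
    by ring.
  have /max_r -> : (0 <= x - y)%R by rewrite subr_ge0.
  have /max_l -> : (y - x <= 0)%R by rewrite subr_le0.
  by ring.
all: by move=> w _; rewrite lee_fin.
Qed.

(** Efron-Stein inequality for a function of finitely many independent
    coordinates whose increase under a change of the coordinate [i] is at most
    the positive part of the new value of this coordinate, and at most zero
    outside the event [Q i]. *)
Theorem efron_stein (s : seq J) (Q : J -> set (config J R)) (M : \bar R) :
  uniq s ->
  (forall x y : config J R, (forall j, j \in s -> (x : J -> R) j = (y : J -> R) j) ->
    f x = f y) ->
  (forall i, measurable (Q i)) ->
  (forall i (x y : config J R), (forall j, j != i -> (x : J -> R) j = (y : J -> R) j) ->
    (f y - f x <= Num.max 0 ((y : J -> R) i) * \1_(Q i) x)%R) ->
  (forall i, \int[P]_w ((X i w) ^+ 2)%:E <= M) ->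
  \int[P \x P]_w (((f (fun j => X j w.1)) - f (fun j => X j w.2)) ^+ 2)%:E <=
  \sum_(i <- s) (M * P [set w | Q i (fun j => X j w)] +
                 M * P [set w | Q i (fun j => X j w)]).
Proof.
move=> us fs mQ fQ XM.
have -> : \int[P \x P]_w ((f (fun j => X j w.1) - f (fun j => X j w.2)) ^+ 2)%:E =
    mix_dist sq pred0 (mem s).
  apply: eq_integral => w _; rewrite /sq; congr (_ ^+ 2)%:E; congr (_ - _)%R.
  by apply: fs => j js; rewrite /mix /doubled /= js.
apply: (le_trans (mix_dist_seq us)); apply: lee_sum => i _.
rewrite mix_dist_one_sided.
have mXc : measurable_fun setT ((fun w j => X j w) : T -> config J R).
  exact: product_law_config lawX.
have mQi : measurable [set w | Q i (fun j => X j w)].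
  by rewrite -[X in measurable X]setTI; exact: mXc.
suff h : mix_dist psq (pred1 i) pred0 <= M * P [set w | Q i (fun j => X j w)].
  exact: leeD.
pose F (w : T * T) : \bar R :=
  (\1_[set w | Q i (fun j => X j w)] w.1)%:E * ((X i w.2) ^+ 2)%:E.
have F0 w : 0 <= F w by rewrite mule_ge0 ?lee_fin ?sqr_ge0.
have mF : measurable_fun setT F.
  apply: emeasurable_funM; apply/measurable_EFinP.
    have m1 : measurable_fun setT (\1_[set w | Q i (fun j => X j w)] : T -> R).
      exact: measurable_indic.
    exact: (measurableT_comp m1 measurable_fst).
  by apply: measurable_funX; apply: (measurableT_comp (mX i)); exact: measurable_snd.
apply: (@le_trans _ _ (\int[P \x P]_w F w)).
  apply: ge0_le_integral => //.
  - by move=> w _; rewrite lee_fin.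
  - exact: measurable_mix_dist.
  move=> w _; rewrite /F -EFinM lee_fin /psq.
  rewrite indicE; apply: psq_bound.
  rewrite (_ : (w.1 \in _) = (mix pred0 w \in Q i)); last by [].
  have := fQ i (mix pred0 w) (mix (pred1 i) w).
  rewrite indicE (_ : (mix (pred1 i) w : J -> R) i = X i w.2).
    by apply=> j /negbTE ji; rewrite /mix /doubled/= ji.
  by rewrite /mix /doubled/= eqxx.
rewrite fubini_tonelli1// /fubini_F /F/=.
set V := \int[P]_w ((X i w) ^+ 2)%:E.
have mX2 : measurable_fun setT (fun w => ((X i w) ^+ 2)%:E).
  by apply/measurable_EFinP; exact: measurable_funX.
have V0 : 0 <= V by apply: integral_ge0 => w _; rewrite lee_fin sqr_ge0.
rewrite (eq_integral (fun x => V * (\1_[set w | Q i (fun j => X j w)] x)%:E)); last first.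
  move=> x _; rewrite ge0_integralZl_EFin// 1?muleC// => w _.
  by rewrite lee_fin sqr_ge0.
rewrite ge0_integralZl//; last by apply/measurable_EFinP; exact: measurable_indic.
by rewrite integral_indic// setIT lee_wpmul2r// XM.
Qed.

End EfronStein.

(** * Real sequences *)

Section RealSequences.
Set Implicit Arguments.
Unset Strict Implicit.
Variable R : realType.

(** Fekete's lemma, for sequences between [0] and [c n]. *)
Lemma fekete (u : nat -> R) (c : R) : (forall n, 0 <= u n) ->
  (forall n, u n <= c * n%:R) -> (forall n k, u (n + k)%N <= u n + u k) ->
  exists mu : R, u n / n%:R @[n --> \oo] --> mu.
Proof.
move=> u0 uc sub.
have c0 : 0 <= c by have := le_trans (u0 1%N) (uc 1%N); rewrite mulr1.
pose S := range (fun n => u n.+1 / n.+1%:R).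
have S0 : lbound S 0.
  by move=> _ [n _ <-]; rewrite divr_ge0.
have hS : has_inf S by split; [exists (u 1%N / 1%:R), 0%N|exists 0].
exists (inf S); apply/cvgrPdist_le => e e0.
have e20 : 0 < e / 2 by rewrite divr_gt0.
have [_ [k _ <-] kS] := inf_adherent e20 hS.
have mulk j : u (j * k.+1)%N <= j%:R * u k.+1.
  elim: j => [|j IH]; first by rewrite mul0n mul0r (le_trans (uc 0%N))// mulr0.
  by rewrite mulSn -[j.+1]add1n natrD mulrDl mul1r (le_trans (sub _ _))// lerD2l.
have key n : u n <= n%:R * (u k.+1 / k.+1%:R) + c * k.+1%:R.
  rewrite {1}(divn_eq n k.+1); apply: (le_trans (sub _ _)); apply: lerD.
    apply: (le_trans (mulk _)); rewrite mulrA ler_pdivlMr ?ltr0n//.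
    rewrite mulrAC; apply: ler_wpM2r => //.
    by rewrite -natrM ler_nat leq_divM.
  by apply: (le_trans (uc _)); rewrite ler_wpM2l// ler_nat ltnW// ltn_pmod.
near=> n.
have n0 : (0 < n)%N by near: n; exact: nbhs_infty_gt.
have n0' : 0 < n%:R :> R by rewrite ltr0n.
have nk : c * k.+1%:R / (e / 2) <= n%:R by near: n; exact: nbhs_infty_ger.
have inf_le : inf S <= u n / n%:R.
  by apply: ge_inf; [exists 0|exists n.-1; rewrite ?prednK].
rewrite distrC ger0_norm ?subr_ge0// lerBlDl ler_pdivrMr//.
apply: (le_trans (key n)).
have h1 : n%:R * (u k.+1 / k.+1%:R) <= n%:R * (inf S + e / 2).
  by rewrite ler_pM2l// ltW.
have h2 : c * k.+1%:R <= n%:R * (e / 2) by rewrite -ler_pdivrMr.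
apply: (le_trans (lerD h1 h2)); rewrite -mulrDr mulrC ler_pM2r//.
by lra.
Unshelve. all: by end_near. Qed.

Lemma cvg_sqr0 (x : nat -> R) : (x n ^+ 2) @[n --> \oo] --> (0 : R) ->
  x n @[n --> \oo] --> (0 : R).
Proof.
move=> /cvgrPdist_lt h; apply/cvgrPdist_lt => e e0.
have := h (e ^+ 2) (exprn_gt0 _ e0); apply: filterS => n /=.
by rewrite !sub0r !normrN normrX ltr_pXn2r// ?nnegrE// ltW.
Qed.

Lemma sqrt_floor n : exists k, (k ^ 2 <= n < k.+1 ^ 2)%N.
Proof.
elim: n => [|n [k /andP[h1 h2]]]; first by exists 0%N.
have [h|h] := ltnP n.+1 (k.+1 ^ 2); first by exists k; rewrite h (leq_trans h1).
by exists k.+1; rewrite h (leq_ltn_trans h2)// ltn_sqr.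
Qed.

(** Convergence along the squares extends to all indices when the increments
    between consecutive squares are negligible. *)
Lemma cvg_from_squares (F D : nat -> R) (mu : R) : 0 <= mu ->
  (F (k ^ 2)%N / (k ^ 2)%:R) @[k --> \oo] --> mu ->
  (D k / (k ^ 2)%:R) @[k --> \oo] --> (0 : R) ->
  (forall k n, (k ^ 2 <= n <= k.+1 ^ 2)%N ->
     F n <= F (k ^ 2)%N + D k /\ F (k.+1 ^ 2)%N <= F n + D k) ->
  F n / n%:R @[n --> \oo] --> mu.
Proof.
move=> mu0 Fcv Dcv gap; apply/cvgrPdist_le => e e0.
have e50 : 0 < e / 5 by rewrite divr_gt0.
move/cvgrPdist_le: Fcv => /(_ _ e50)[K1 _ H1].
move/cvgrPdist_le: Dcv => /(_ _ e50)[K2 _ H2].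
pose K := (maxn K1 K2).+1.
exists (K ^ 2)%N => // n /= Kn.
have [k /andP[kn nk]] := sqrt_floor n.
have Kk : (K <= k)%N.
  by rewrite -ltnS -ltn_sqr (leq_ltn_trans Kn).
have k0 : (0 < k)%N by rewrite (leq_trans _ Kk).
have n0 : 0 < n%:R :> R by rewrite ltr0n (leq_trans _ kn)// expn_gt0 k0.
have kR : 0 < (k ^ 2)%:R :> R by rewrite ltr0n expn_gt0 k0.
have k1R : 0 < (k.+1 ^ 2)%:R :> R by rewrite ltr0n expn_gt0.
have kK1 : (K1 <= k)%N by rewrite (leq_trans (leq_maxl K1 K2))// (leq_trans _ Kk).
have kK2 : (K2 <= k)%N by rewrite (leq_trans (leq_maxr K1 K2))// (leq_trans _ Kk).
have a1 := H1 k kK1; have a2 := H2 k kK2.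
have a3 := H1 k.+1 (leq_trans kK1 (leqnSn k)).
rewrite /= in a1 a2 a3.
have b1 : F (k ^ 2)%N <= (mu + e / 5) * (k ^ 2)%:R.
  rewrite -ler_pdivrMr//; move: a1; rewrite ler_norml => /andP[+ _]; lra.
have b2 : D k <= e / 5 * (k ^ 2)%:R.
  rewrite -ler_pdivrMr//; move: a2; rewrite sub0r normrN.
  exact/le_trans/ler_norm.
have b3 : (mu - e / 5) * (k.+1 ^ 2)%:R <= F (k.+1 ^ 2)%N.
  rewrite -ler_pdivlMr//; move: a3; rewrite ler_norml => /andP[_].
  by rewrite !lerBlDr addrC.
have knR : (k ^ 2)%:R <= n%:R :> R by rewrite ler_nat.
have nkR : n%:R <= (k.+1 ^ 2)%:R :> R by rewrite ler_nat ltnW.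
have k4 : (k.+1 ^ 2)%:R <= 4 * (k ^ 2)%:R :> R.
  by rewrite -natrM ler_nat -(expnMn 2 k 2) leq_sqr mul2n -addnn -addn1 leq_add2l.
have [|c1 c2] := gap k n; first by rewrite kn ltnW.
have r : F n / n%:R * n%:R = F n by rewrite divfK// gt_eqF.
rewrite /= ler_norml lerNl opprB lerBlDr lerBlDr ler_pdivrMr// -lerBlDl ler_pdivlMr//.
move: (F n) (F (k ^ 2)%N) (F (k.+1 ^ 2)%N) (D k) b1 b2 b3 c1 c2 => x y z t b1 b2 b3 c1 c2.
move: (n%:R) ((k ^ 2)%:R) ((k.+1 ^ 2)%:R) knR nkR k4 b1 b2 b3 => p g h gp ph hg b1 b2 b3.
have p1 : 0 <= mu * (p - g) by rewrite mulr_ge0// subr_ge0.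
have p2 : 0 <= mu * (h - p) by rewrite mulr_ge0// subr_ge0.
have p3 : 0 <= e * (p - g) by rewrite mulr_ge0 ?subr_ge0// ltW.
have p4 : 0 <= e * (4 * g - h) by rewrite mulr_ge0 ?subr_ge0// ltW.
by apply/andP; split; nra.
Qed.

Lemma sum_inv_sqr_le n : \sum_(0 <= k < n) (k.+1%:R ^+ 2)^-1 <= 2 :> R.
Proof.
have : \sum_(0 <= k < n) (k.+1%:R ^+ 2)^-1 <= 2 - 2 / n.+1%:R :> R.
  elim: n => [|n IH]; first by rewrite big_geq// divr1 subrr.
  rewrite big_nat_recr//=; apply: (le_trans (lerD IH (lexx _))).
  have n1 : 0 < n.+1%:R :> R by rewrite ltr0n.
  have -> : n.+2%:R = n.+1%:R + 1 :> R by rewrite -natr1.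
  have n2 : 1 <= n.+1%:R :> R by rewrite ler1n.
  set x := n.+1%:R in n1 n2 *.
  rewrite -subr_ge0.
  have -> : 2 - 2 / (x + 1) - (2 - 2 / x + (x ^+ 2)^-1) =
     (x - 1) / (x ^+ 2 * (x + 1)).
    by field; rewrite ?gt_eqF// ltr_wpDl.
  by rewrite divr_ge0 ?subr_ge0// mulr_ge0 ?sqr_ge0// addr_ge0// ltW.
by move=> /le_trans; apply; rewrite gerBl divr_ge0.
Qed.

Lemma sqr_sum_le (I : Type) (s : seq I) (a : I -> R) :
  (\sum_(i <- s) a i) ^+ 2 <= (size s)%:R * \sum_(i <- s) a i ^+ 2.
Proof.
elim: s => [|i s IH]; first by rewrite !big_nil expr0n mul0r.
rewrite !big_cons /= -[(size s).+1]add1n natrD.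
have h : 2 * (a i * \sum_(j <- s) a j) <= (size s)%:R * a i ^+ 2 + \sum_(j <- s) a j ^+ 2.
  elim: (s) => [|j r IHr]; first by rewrite !big_nil !mulr0 mul0r addr0.
  rewrite !big_cons /= -[(size r).+1]add1n natrD.
  have : 0 <= (a i - a j) ^+ 2 by exact: sqr_ge0.
  nra.
nra.
Qed.

End RealSequences.

(** * Paths with many cheap edges *)

Section CheapPaths.
Set Implicit Arguments.
Unset Strict Implicit.
Local Open Scope ereal_scope.
Variables (R : realType) (d : nat) (disp : measure_display)
  (T : measurableType disp) (P : probability T R)
  (X : edge d -> T -> R) (nu : set R -> \bar R) (eps : R).
Hypothesis d0 : (0 < d)%N.
Hypothesis lawX : product_law P X nu.
Hypothesis eps0 : (0 < eps)%R.
Hypothesis nu_small : nu [set x | (x < eps)%R] <= ((16 * d%:R)^-1 ^+ 2)%:E.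

Let mlt : measurable [set x : R | (x < eps)%R].
Proof.
by rewrite (_ : mkset _ = `]-oo, eps[%classic)//; apply/seteqP; split=> x /=; rewrite in_itv.
Qed.

(** The walk [pm.1] from the origin has [r] distinct edges, and [pm.2] selects at
    least half of them, all of passage time less than [eps]. *)
Definition cheap_along r (pm : seq (vertex d) * r.-tuple bool) : set T :=
  if uniq (edges_along 0%R pm.1) && (size (edges_along 0%R pm.1) == r) &&
     (r <= 2 * count id pm.2)%N
  then [set w | forall e, e \in mask pm.2 (edges_along 0%R pm.1) -> (X e w < eps)%R]
  else set0.

(** The walks with [r] steps from the origin, with a selection of their edges. *)
Definition walk_masks r : seq (seq (vertex d) * r.-tuple bool) :=
  [seq (p, m) | p <- walks 0%R r, m <- enum {: r.-tuple bool}].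

(** Some walk of [r] distinct edges from the origin has at least half of its
    edges cheap, that is, of passage time less than [eps]. *)
Definition cheap_path r : set T :=
  [set w | exists2 pm, pm \in walk_masks r & cheap_along pm w].

Lemma measurable_cheap_along r pm : measurable (@cheap_along r pm).
Proof.
rewrite /cheap_along; case: ifP => // _.
by apply: (@measurable_finite_event _ _ _ _ X _ (fun=> [set x | (x < eps)%R])) => //; exact: lawX.1.
Qed.

Lemma measure_exists_seq (I : eqType) (s : seq I) (E : I -> set T) :
  (forall i, measurable (E i)) ->
  measurable [set w | exists2 i, i \in s & E i w] /\
  P [set w | exists2 i, i \in s & E i w] <= \sum_(i <- s) P (E i).
Proof.
move=> mE; elim: s => [|i s [mIH IH]].
  by rewrite big_nil (_ : mkset _ = set0) ?measure0//; apply/seteqP; split=> w //= [].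
rewrite (_ : mkset _ = E i `|` [set w | exists2 i, i \in s & E i w]); last first.
  apply/seteqP; split=> w /=.
    by move=> [j]; rewrite inE => /predU1P[->|js] Ew; [left|right; exists j].
  by move=> [Ew|[j js Ew]]; [exists i|exists j] => //; rewrite inE ?eqxx ?js ?orbT.
split; first exact: measurableU.
rewrite big_cons; apply: le_trans (leeD2l _ IH).
exact: measureU2.
Qed.

(** At least [r / 2] distinct edges are cheap, each with probability at most
    [c ^+ 2] where [c := (16 * d)^-1]. *)
Lemma measure_cheap_along r pm :
  P (@cheap_along r pm) <= ((16 * d%:R)^-1 ^+ r)%:E.
Proof.
have nus := nu_small; set c := (16 * d%:R)^-1%R in nus *.
have c0 : (0 <= c)%R by rewrite invr_ge0 mulr_ge0.
have c1 : (c <= 1)%R.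
  by rewrite invf_le1 ?mulr_gt0 ?ltr0n// -natrM ler1n muln_gt0.
rewrite /cheap_along; case: ifP => [/andP[/andP[us /eqP ss] rm]|_]; last first.
  by rewrite measure0 lee_fin exprn_ge0.
move: us ss; set s := edges_along _ _ => us ss.
have um := mask_uniq us pm.2.
rewrite (lawX.2 _ (fun=> [set x | (x < eps)%R]) um)//.
apply: (@le_trans _ _ (((c ^+ 2) ^+ size (mask pm.2 s))%:E)).
  elim: (mask _ _) um => [|e u IH /= /andP[_ uu]]; first by rewrite big_nil expr0.
  have nu0 : 0 <= nu [set x | (x < eps)%R].
    have := lawX.2 [:: e] (fun=> [set x | (x < eps)%R]) isT (fun=> mlt).
    by rewrite big_seq1 => <-.
  rewrite big_cons exprS EFinM lee_pmul ?IH//.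
  by elim/big_ind: _ => // x y ? ?; rewrite mule_ge0.
rewrite lee_fin -exprM size_mask ?size_tuple ?ss//.
by rewrite ler_wiXn2l.
Qed.

Lemma measurable_cheap_path r : measurable (cheap_path r).
Proof. by have [] := @measure_exists_seq _ (walk_masks r) _ (@measurable_cheap_along r). Qed.

(** There are [(2 * d) ^ r] walks with [2 ^ r] selections each, and
    [4 * d * (16 * d)^-1 = 4^-1]. *)
Lemma measure_cheap_path r : P (cheap_path r) <= ((4^-1) ^+ r)%:E.
Proof.
have [_ le1] := @measure_exists_seq _ (walk_masks r) _ (@measurable_cheap_along r).
apply: (le_trans le1).
apply: (@le_trans _ _ (\sum_(pm <- walk_masks r) ((16 * d%:R)^-1 ^+ r)%:E)).
  by apply: lee_sum => pm _; exact: measure_cheap_along.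
rewrite sumEFin lee_fin big_const_seq count_predT iter_addr_0 -[leLHS]mulr_natl.
rewrite size_allpairs size_walks -cardE card_tuple card_bool.
rewrite -expnMn natrX -exprMn; apply: lerXn2r; rewrite ?nnegrE//.
have d1 : d%:R != 0%R :> R by rewrite pnatr_eq0 -lt0n.
by rewrite !natrM le_eqVlt; apply/orP; left; apply/eqP; field.
Qed.

(** The sum of the lengths [r] for which [cheap_path r] occurs: every path
    from the origin longer than [excess] costs at least [eps / 2] per edge. *)
Definition excess (w : T) : \bar R := \sum_(0 <= r <oo) (r%:R * \1_(cheap_path r) w)%:E.

Let excess_term_ge0 r w : 0 <= (r%:R * \1_(cheap_path r) w)%:E :> \bar R.
Proof. by rewrite lee_fin mulr_ge0. Qed.

Let measurable_excess_term r :
  measurable_fun setT (fun w => (r%:R * \1_(cheap_path r) w)%:E : \bar R).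
Proof.
apply/measurable_EFinP; apply: measurable_funM => //.
exact: measurable_indic (measurable_cheap_path r).
Qed.

Lemma excess_ge0 w : 0 <= excess w.
Proof. exact: nneseries_ge0. Qed.

Lemma measurable_excess : measurable_fun setT excess.
Proof. by apply: ge0_emeasurable_sum. Qed.

Lemma integral_excess : \int[P]_w excess w <= 2%:E.
Proof.
rewrite integral_nneseries//.
apply: le_trans (epsilon_trick0 xpredT (ler0n R 2)).
apply: lee_nneseries => [r _ _|r _]; first exact: integral_ge0.
rewrite (eq_integral (fun w => r%:R%:E * (\1_(cheap_path r) w)%:E))//.
rewrite ge0_integralZl_EFin//; last first.
  exact/measurable_EFinP/measurable_indic/measurable_cheap_path.
rewrite integral_indic ?setIT//; last exact: measurable_cheap_path.
apply: (@le_trans _ _ (r%:R%:E * ((4^-1) ^+ r)%:E)).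
  by rewrite lee_wpmul2l ?lee_fin// measure_cheap_path.
rewrite -EFinM lee_fin (_ : 4%R = 2 * 2 :> R)%R; last by rewrite -natrM.
rewrite exprVn exprMn invfM mulrA expnS natrM.
rewrite [leRHS](_ : _ = (2 ^+ r)^-1)%R; last first.
  by rewrite natrX invfM mulrA divff ?mul1r.
by rewrite ler_piMl// ler_pdivrMr ?exprn_gt0// mul1r -natrX ler_nat ltnW// ltn_expl.
Qed.

(** If more than half of the edges of [s] have passage time at least [eps], then
    [s] costs at least [eps / 2] per edge; otherwise its length is a summand of
    [excess]. *)
Lemma path_length_bound (y : vertex d) (s : seq (edge d)) w :
  paths 0%R y s -> excess w < +oo ->
  ((size s)%:R <= passage_time (fun e => Num.max (X e w) 0%R) s / (eps / 2) +
                  fine (excess w))%R.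
Proof.
move=> ps fin_ex.
have us := paths_uniq ps; case/pathsP: ps => p [pa up lp sE].
have tau0 e : (0 <= Num.max (X e w) 0)%R by rewrite le_max lexx orbT.
pose a (e : edge d) := (X e w < eps)%R.
have [many|few] := leqP (size s) (2 * count a s).
  have wbad : cheap_path (size s) w.
    exists (p, map_tuple a (in_tuple s)) => /=.
      apply/allpairsP; exists (p, map_tuple a (in_tuple s)); split=> //=.
        by rewrite sE size_edges_along//; exact: mem_walks.
      by rewrite mem_enum.
    rewrite /cheap_along /= -sE us eqxx/= count_map many => e.
    by rewrite -filter_mask mem_filter => /andP[].
  have h : (size s)%:R%:E <= excess w.
    apply: le_trans (nneseries_lim_ge (size s).+1 _) => //.
    rewrite big_nat_recr//= indicE mem_set// mulr1 leeDr//.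
    exact: sume_ge0.
  rewrite (@le_trans _ _ (fine (excess w)))//; last first.
    by rewrite lerDr divr_ge0 ?passage_time_ge0// divr_ge0// ltW.
  by rewrite -lee_fin fineK// ge0_fin_numE// excess_ge0.
apply: (@le_trans _ _ (passage_time (fun e => Num.max (X e w) 0%R) s / (eps / 2))%R).
  rewrite ler_pdivlMr ?divr_gt0//.
  have -> : passage_time (fun e => Num.max (X e w) 0%R) s =
      (\sum_(e <- s | a e) Num.max (X e w) 0 +
       \sum_(e <- s | ~~ a e) Num.max (X e w) 0)%R.
    by rewrite /passage_time (bigID a).
  have le1 : (\sum_(e <- s | ~~ a e) eps <= \sum_(e <- s | ~~ a e) Num.max (X e w) 0)%R.
    by apply: ler_sum => e; rewrite /a -leNgt le_max => ->.
  have ge0 : (0 <= \sum_(e <- s | a e) Num.max (X e w) 0)%R by exact: sumr_ge0.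
  apply: (le_trans _ (lerD ge0 le1)).
  rewrite add0r big_const_seq iter_addr_0 -[leRHS]mulr_natr mulrCA.
  apply: ler_wpM2l; first exact: ltW.
  rewrite ler_pdivrMr// -natrM ler_nat.
  have := count_predC a s.
  rewrite (@eq_count _ (predC a) (fun e => ~~ a e))//.
  by move: few; clear; lia.
by rewrite lerDl fine_ge0// excess_ge0.
Qed.

End CheapPaths.

(** * Variance and mean of the passage time along the axis *)

Section MeasurableInf.
Set Implicit Arguments.
Unset Strict Implicit.

Lemma measurable_ereal_inf_countable (R : realType) (I : countType)
    (disp : measure_display) (T : measurableType disp) (A : set I)
    (g : I -> T -> \bar R) :
  (forall i, measurable_fun setT (g i)) ->
  measurable_fun setT (fun x => ereal_inf [set g i x | i in A]).
Proof.
move=> mg.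
pose h n x := if @choice.unpickle I n is Some i then if `[< A i >] then g i x else +oo%E else +oo%E.
have mh n : measurable_fun setT (h n).
  by rewrite /h; case: (choice.unpickle n) => [i|]//; case: `[<A i>].
rewrite (_ : (fun x => _) = (fun x => einfs (h^~ x) 0)); first exact: measurable_fun_einfs.
apply/funext => x; rewrite /einfs; apply/eqP; rewrite eq_le; apply/andP; split.
  apply: le_ereal_inf_tmp => _ [n _ <-]; rewrite /h.
  case: (choice.unpickle n) => [i|]; last by rewrite leey.
  by case: asboolP => [Ai|_]; [apply: ereal_inf_lbound; exists i|rewrite leey].
apply: le_ereal_inf_tmp => _ [i Ai <-]; apply: ereal_inf_lbound.
by exists (choice.pickle i) => //; rewrite /h choice.pickleK asboolT.
Qed.

End MeasurableInf.

Section Configurations.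
Set Implicit Arguments.
Unset Strict Implicit.
Variables (R : realType) (d : nat).

(** The passage times of a configuration, with negative values replaced by
    zero. *)
Definition ptimes (x : config (edge d) R) : edge d -> R :=
  fun e => Num.max ((x : edge d -> R) e) 0.

Lemma ptimes_ge0 x e : 0 <= ptimes x e.
Proof. by rewrite /ptimes le_max lexx orbT. Qed.

Lemma measurable_passage_time s :
  measurable_fun setT (fun x => passage_time (ptimes x) s).
Proof.
apply: measurable_sum => e; apply: measurable_maxr => //.
exact: (measurable_coord e).
Qed.

Lemma measurable_first_passage A :
  measurable_fun setT (fun x => first_passage (ptimes x) A).
Proof.
apply: measurable_ereal_inf_countable => s; apply/measurable_EFinP.
exact: measurable_passage_time.
Qed.

(** The first passage time over [A] in a configuration, as a real number; it is
    meaningful for nonempty [A], where the first passage time is finite. *)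
Definition travel A (x : config (edge d) R) : R := fine (first_passage (ptimes x) A).

Lemma measurable_travel A : measurable_fun setT (travel A).
Proof. by apply: measurableT_comp => //; exact: measurable_first_passage. Qed.

Lemma travel_ge0 A x : 0 <= travel A x.
Proof. by apply: fine_first_passage_ge0; exact: ptimes_ge0. Qed.

(** The configurations for which [e] lies on every nearly optimal path. When no
    path of [A] avoids [e], the right-hand side is [+oo]. *)
Definition pivotal A (e : edge d) : set (config (edge d) R) :=
  [set x | (first_passage (ptimes x) A < first_passage (ptimes x) (avoiding e A))%E].

Lemma measurable_pivotal A e : measurable (pivotal A e).
Proof.
rewrite -[X in measurable X]setTI.
by apply: emeasurable_fun_lt => //; exact: measurable_first_passage.
Qed.

Lemma travel_perturb (A : set (seq (edge d))) e (x y : config (edge d) R) :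
  (forall s, A s -> uniq s) -> A !=set0 ->
  (forall f, f != e -> (x : edge d -> R) f = (y : edge d -> R) f) ->
  travel A y - travel A x <= Num.max 0 ((y : edge d -> R) e) * \1_(pivotal A e) x.
Proof.
move=> uA A0 xy.
have := @first_passage_perturb _ _ (ptimes x) (ptimes y) e A (ptimes_ge0 x) (ptimes_ge0 y).
move=> /(_ _ uA A0) h; rewrite maxC indicE; apply: le_trans (h _) _.
  by move=> f /xy; rewrite /ptimes => ->.
rewrite le_eqVlt; apply/orP; left; apply/eqP; congr (_ * _%:R).
by congr nat_of_bool; apply/idP/idP => [h'|/set_mem//]; exact/mem_set.
Qed.

End Configurations.

Section Variance.
Set Implicit Arguments.
Unset Strict Implicit.
Local Open Scope ereal_scope.
Variables (R : realType) (d : nat) (disp : measure_display)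
  (T : measurableType disp) (P : probability T R)
  (X : edge d -> T -> R) (nu : set R -> \bar R) (eps M : R) (q : nat -> edge d).
Hypothesis d0 : (0 < d)%N.
Hypothesis lawX : product_law P X nu.
Hypothesis eps0 : (0 < eps)%R.
Hypothesis nu_small : nu [set x | (x < eps)%R] <= ((16 * d%:R)^-1 ^+ 2)%:E.
Hypothesis XM : forall e, \int[P]_w ((X e w) ^+ 2)%:E <= M%:E.
Hypothesis bij_q : bijective q.

(** The random configuration. *)
Definition sample (w : T) : config (edge d) R := fun e => X e w.

Lemma measurable_sample : measurable_fun setT sample.
Proof. exact: product_law_config lawX. Qed.

Lemma M_ge0 : (0 <= M)%R.
Proof.
rewrite -lee_fin (le_trans _ (XM (axis_edge d0 0)))//.
by apply: integral_ge0 => w _; rewrite lee_fin sqr_ge0.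
Qed.

Lemma measurable_travel_sample A : measurable_fun setT (fun w => travel A (sample w)).
Proof. exact: (measurableT_comp (measurable_travel A) measurable_sample). Qed.

Lemma measurable_ptimes_sample e : measurable_fun setT (fun w => ptimes (sample w) e).
Proof. by apply: measurable_maxr => //; exact: lawX.1. Qed.

(** A consequence of [x <= 1 + x ^+ 2]. *)
Lemma integral_ptimes e : \int[P]_w (ptimes (sample w) e)%:E <= (1 + M)%:E.
Proof.
apply: (@le_trans _ _ (\int[P]_w (1 + ((X e w) ^+ 2)%:E))).
  apply: ge0_le_integral => //.
  - by move=> w _; rewrite lee_fin ptimes_ge0.
  - by apply/measurable_EFinP; exact: measurable_ptimes_sample.
  - apply: emeasurable_funD => //; apply/measurable_EFinP/measurable_funX.
    exact: lawX.1.
  - move=> w _; rewrite -EFinD lee_fin /ptimes ge_max; apply/andP; split.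
      rewrite /sample; set x := X e w; nra.
    by rewrite addr_ge0 ?sqr_ge0.
rewrite ge0_integralD//; last 2 first.
- by move=> w _; rewrite lee_fin sqr_ge0.
- by apply/measurable_EFinP/measurable_funX; exact: lawX.1.
rewrite integral_cst//= probability_setT mule1 EFinD.
by rewrite leeD2l.
Qed.

Lemma integral_ptimes_sum (s : seq (edge d)) :
  \int[P]_w (\sum_(e <- s) ptimes (sample w) e)%:E <= ((size s)%:R * (1 + M))%:E.
Proof.
under eq_integral do rewrite -sumEFin.
rewrite ge0_integral_sum//; last 2 first.
- by move=> e; apply/measurable_EFinP; exact: measurable_ptimes_sample.
- by move=> e w _; rewrite lee_fin ptimes_ge0.
elim: s => [|e s IH]; first by rewrite big_nil mul0r.
rewrite big_cons /= -[(size s).+1]add1n natrD mulrDl mul1r EFinD.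
by rewrite leeD ?integral_ptimes.
Qed.

(** The mean number of pivotal edges is at most the mean number of edges of a
    nearly optimal path. *)
Lemma sum_pivotal_le (A : set (seq (edge d))) y (es : seq (edge d)) (B : R) :
  (forall s, A s -> paths 0%R y s) -> A !=set0 -> uniq es ->
  \int[P]_w (travel A (sample w))%:E <= B%:E ->
  \sum_(e <- es) P [set w | pivotal A e (sample w)] <= (B / (eps / 2) + 3)%:E.
Proof.
move=> Ap A0 ues intB.
have mpiv e : measurable [set w | pivotal A e (sample w)].
  rewrite -[X in measurable X]setTI; apply: measurable_sample => //.
  exact: measurable_pivotal.
have a0 : (0 < eps / 2)%R by rewrite divr_gt0.
have -> : \sum_(e <- es) P [set w | pivotal A e (sample w)] =
    \int[P]_w \sum_(e <- es) (\1_[set w | pivotal A e (sample w)] w)%:E.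
  rewrite ge0_integral_sum//.
    by apply: eq_bigr => e _; rewrite integral_indic// setIT.
  by move=> e; apply/measurable_EFinP; exact: measurable_indic.
have mt : measurable_fun setT (fun w => (travel A (sample w) / (eps / 2))%:E).
  by apply/measurable_EFinP; apply: measurable_funM => //; exact: measurable_travel_sample.
have t0 w : 0 <= (travel A (sample w) / (eps / 2))%:E.
  by rewrite lee_fin divr_ge0 ?travel_ge0// ltW.
have mex := measurable_excess eps lawX.
have ex0 w := excess_ge0 X eps w.
apply: (@le_trans _ _ (\int[P]_w ((travel A (sample w) / (eps / 2))%:E + (1 + excess X eps w)))).
  apply: ge0_le_integral => //.
  - by move=> w _; apply: sume_ge0.
  - apply: emeasurable_sum => e; apply/measurable_EFinP; exact: measurable_indic.
  - by apply: emeasurable_funD => //; exact: emeasurable_funD.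
  move=> w _.
  have [exw|] := ltP (excess X eps w) +oo; last first.
    by rewrite leye_eq => /eqP ->; rewrite addey ?addey ?leey.
  have piv_in e : [set w | pivotal A e (sample w)] w =
    (first_passage (ptimes (sample w)) A <
     first_passage (ptimes (sample w)) (avoiding e A)) :> Prop by [].
  pose I := [seq e <- es | first_passage (ptimes (sample w)) A <
     first_passage (ptimes (sample w)) (avoiding e A)].
  have -> : \sum_(e <- es) (\1_[set w | pivotal A e (sample w)] w : R)%:E = (size I)%:R%:E.
    rewrite sumEFin /I size_filter -sum1_count natr_sum; congr EFin.
    rewrite [RHS]big_mkcond.
    apply: eq_bigr => e _; rewrite indicE.
    by case: ifP => h; [rewrite [_ \in _]asboolT|rewrite [_ \in _]asboolF// piv_in h].
  rewrite -[excess X eps w]fineK ?ge0_fin_numE// -!EFinD lee_fin addrA.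
  apply: (@pivotal_count _ _ (ptimes (sample w)) A I) => //.
  - exact: ptimes_ge0.
  - exact: filter_uniq.
  - move=> s As; exact: (path_length_bound eps0 (Ap _ As) exw).
  - by move=> e; rewrite mem_filter => /andP[].
rewrite ge0_integralD//; last 2 first.
- by move=> w _; rewrite adde_ge0.
- exact: emeasurable_funD.
rewrite ge0_integralD// integral_cst//= probability_setT mule1.
have -> : (B / (eps / 2) + 3)%:E = (B / (eps / 2))%:E + (1 + 2%:E).
  by rewrite -!EFinD; congr EFin; lra.
apply: leeD; last by rewrite leeD2l// (integral_excess d0 lawX nu_small).
under eq_integral do rewrite mulrC EFinM.
rewrite ge0_integralZl_EFin//; last 3 first.
- by move=> w _; rewrite lee_fin travel_ge0.
- by apply/measurable_EFinP; exact: measurable_travel_sample.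
- by rewrite invr_ge0 ltW.
by rewrite [(B / _)%R]mulrC EFinM lee_wpmul2l// lee_fin invr_ge0 ltW.
Qed.

(** Jensen's inequality for the square. *)
Lemma sqr_mean_le (F : T -> R) (m a : R) : measurable_fun setT F ->
  (forall w, (0 <= F w)%R) -> \int[P]_w (F w)%:E = m%:E ->
  ((a - m) ^+ 2)%:E <= \int[P]_w ((a - F w) ^+ 2)%:E.
Proof.
move=> mF F0 intF.
have mq : measurable_fun setT (fun w => ((a - F w) ^+ 2)%:E).
  by apply/measurable_EFinP/measurable_funX; exact: measurable_funB.
have mFE : measurable_fun setT (fun w => (F w)%:E) by exact/measurable_EFinP.
have q0 w : 0 <= ((a - F w) ^+ 2)%:E by rewrite lee_fin sqr_ge0.
have m0 : (0 <= m)%R by rewrite -lee_fin -intF integral_ge0// => w _; rewrite lee_fin.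
have intC (c k : R) : (0 <= c)%R -> (0 <= k)%R ->
    \int[P]_w (k%:E + (c * F w)%:E) = (k + c * m)%:E.
  move=> c0 k0; rewrite ge0_integralD//; last 2 first.
  - by move=> w _; rewrite lee_fin mulr_ge0.
  - by apply/measurable_EFinP; exact: measurable_funM.
  rewrite integral_cst//= probability_setT mule1.
  under eq_integral do rewrite EFinM.
  rewrite ge0_integralZl_EFin//; last by move=> w _; rewrite lee_fin.
  by rewrite intF.
(* Both sides are shifted so that only nonnegative functions are integrated. *)
have [c0|/ltW c0] := lerP 0%R (a - m)%R.
  have c20 : (0 <= 2 * (a - m))%R by rewrite mulr_ge0.
  have h : \int[P]_w ((a - m) ^+ 2 + 2 * (a - m) * m)%:E <=
      \int[P]_w (((a - F w) ^+ 2)%:E + (2 * (a - m) * F w)%:E).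
    apply: ge0_le_integral => //.
    - by move=> w _; rewrite lee_fin addr_ge0 ?sqr_ge0// mulr_ge0.
    - apply: emeasurable_funD => //; apply/measurable_EFinP; exact: measurable_funM.
    - move=> w _; rewrite -EFinD lee_fin -subr_ge0.
      rewrite (_ : _ - _ = (m - F w) ^+ 2)%R ?sqr_ge0//; ring.
  rewrite integral_cst//= probability_setT mule1 in h.
  rewrite ge0_integralD// in h; last 2 first.
  - by move=> w _; rewrite lee_fin mulr_ge0.
  - by apply/measurable_EFinP; exact: measurable_funM.
  have := intC (2 * (a - m))%R 0%R c20 (lexx _).
  under eq_integral do rewrite add0e; rewrite add0r => e; rewrite e in h.
  by rewrite EFinD leeD2rE in h.
have c20 : (0 <= 2 * (m - a))%R by rewrite mulr_ge0// subr_ge0 -subr_le0.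
have h : \int[P]_w (((a - m) ^+ 2)%:E + (2 * (m - a) * F w)%:E) <=
    \int[P]_w (((a - F w) ^+ 2)%:E + (2 * (m - a) * m)%:E).
  apply: ge0_le_integral => //.
  - by move=> w _; rewrite adde_ge0// lee_fin ?sqr_ge0// mulr_ge0.
  - apply: emeasurable_funD => //; apply/measurable_EFinP; exact: measurable_funM.
  - exact: emeasurable_funD.
  - move=> w _; rewrite -!EFinD lee_fin -subr_ge0.
    rewrite (_ : _ - _ = (m - F w) ^+ 2)%R ?sqr_ge0//; ring.
rewrite intC ?sqr_ge0// in h.
rewrite ge0_integralD// in h; last by move=> w _; rewrite lee_fin mulr_ge0.
by rewrite [X in _ + X]integral_cst//= probability_setT mule1 EFinD leeD2rE in h.
Qed.

Lemma variance_le_double (F : T -> R) (m : R) : measurable_fun setT F ->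
  (forall w, (0 <= F w)%R) -> \int[P]_w (F w)%:E = m%:E ->
  \int[P]_w ((F w - m) ^+ 2)%:E <= \int[P \x P]_w ((F w.1 - F w.2) ^+ 2)%:E.
Proof.
move=> mF F0 intF.
have md : measurable_fun setT (fun w : T * T => ((F w.1 - F w.2) ^+ 2)%:E).
  apply/measurable_EFinP/measurable_funX; apply: measurable_funB.
    exact: (measurableT_comp mF measurable_fst).
  exact: (measurableT_comp mF measurable_snd).
have d0' (w : T * T) : 0 <= ((F w.1 - F w.2) ^+ 2)%:E by rewrite lee_fin sqr_ge0.
rewrite fubini_tonelli1//; apply: ge0_le_integral => //.
- by move=> w _; rewrite lee_fin sqr_ge0.
- by apply/measurable_EFinP/measurable_funX; exact: measurable_funB.
- exact: measurable_fun_fubini_tonelli_F.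
- by move=> w _; rewrite /fubini_F/=; exact: sqr_mean_le.
Qed.

Lemma double_variance_finite (A : set (seq (edge d))) y (es : seq (edge d)) (B : R) :
  (forall s, A s -> paths 0%R y s) -> A !=set0 -> uniq es ->
  (forall s, A s -> {subset s <= es}) ->
  \int[P]_w (travel A (sample w))%:E <= B%:E ->
  \int[P \x P]_w ((travel A (sample w.1) - travel A (sample w.2)) ^+ 2)%:E <=
  (2 * M * (B / (eps / 2) + 3))%:E.
Proof.
move=> Ap A0 ues Aes intB.
have uA s : A s -> uniq s by move=> /Ap; exact: paths_uniq.
apply: (le_trans (efron_stein (P := P) (Q := pivotal A) lawX (measurable_travel A) ues _ _ _ XM)).
- move=> x z xz; rewrite /travel; congr fine; congr ereal_inf.
  apply/seteqP; split=> _ [s As <-]; exists s => //; congr EFin;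
    apply: eq_big_seq => e es_; rewrite /ptimes xz//; exact: (Aes s).
- exact: measurable_pivotal.
- by move=> e x z xz; apply: travel_perturb.
apply: (@le_trans _ _ (\sum_(i <- es) ((2 * M)%:E * P [set w | pivotal A i (sample w)]))).
  by apply: lee_sum => i _; rewrite EFinM -muleA mule_natl mule2n.
rewrite [leLHS](_ : _ = (2 * M)%:E * \sum_(e <- es) P [set w | pivotal A e (sample w)]);
  last by rewrite ge0_sume_distrr.
rewrite [leRHS]EFinM lee_wpmul2l ?lee_fin ?mulr_ge0 ?M_ge0//.
exact: (sum_pivotal_le Ap A0 ues intB).
Qed.

(* Paths using only the first [N] edges. *)
Let truncated n N : set (seq (edge d)) :=
  [set s | paths 0%R (axis_point d n) s /\ {subset s <= [seq q i | i <- iota 0 N]}].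

Let uniq_first N : uniq [seq q i | i <- iota 0 N].
Proof. by rewrite map_inj_uniq ?iota_uniq//; exact: bij_inj. Qed.

Let first_subset (s : seq (edge d)) :
  exists N0, forall N, (N0 <= N)%N -> {subset s <= [seq q i | i <- iota 0 N]}.
Proof.
case: bij_q => q' _ q'K; elim: s => [|e s [N0 IH]]; first by exists 0%N.
exists (maxn N0 (q' e).+1) => N; rewrite geq_max => /andP[h1 h2] f.
rewrite inE => /predU1P[->|fs]; last exact: (IH N).
by apply/mapP; exists (q' e); rewrite ?q'K// mem_iota.
Qed.

(** The bound given by [efron_stein], [integral_ptimes_sum] and
    [sum_pivotal_le]. *)
Definition variance_bound (n : nat) : R :=
  (2 * M * (n%:R * (1 + M) / (eps / 2) + 3))%R.

Lemma axis_in_paths n : paths 0%R (axis_point d n) (map (axis_edge d0) (iota 0 n)).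
Proof. by have := axis_edges_paths d0 0 n; rewrite add0n axis_point0. Qed.

Lemma integral_travel_axis (A : set (seq (edge d))) n :
  A (map (axis_edge d0) (iota 0 n)) ->
  \int[P]_w (travel A (sample w))%:E <= (n%:R * (1 + M))%:E.
Proof.
move=> As; have := integral_ptimes_sum (map (axis_edge d0) (iota 0 n)).
rewrite size_map size_iota; apply: le_trans; apply: ge0_le_integral => //.
- by move=> w _; rewrite lee_fin travel_ge0.
- by apply/measurable_EFinP; exact: measurable_travel_sample.
- apply/measurable_EFinP/measurable_sum => e; exact: measurable_ptimes_sample.
move=> w _; rewrite lee_fin -lee_fin -first_passageE; last by exists (map (axis_edge d0) (iota 0 n)).
  exact: first_passage_le.
exact: ptimes_ge0.
Qed.

(** Twice the variance of the passage time to [(n, 0, ..., 0)], expressed with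
    two independent copies, is at most of order [n]. *)
Lemma double_variance n :
  \int[P \x P]_w ((travel (paths 0%R (axis_point d n)) (sample w.1) -
                   travel (paths 0%R (axis_point d n)) (sample w.2)) ^+ 2)%:E <=
  (variance_bound n)%:E.
Proof.
have [N0 N0P] := first_subset (map (axis_edge d0) (iota 0 n)).
pose F A (w : T * T) := ((travel A (sample w.1) - travel A (sample w.2)) ^+ 2)%:E.
pose AN k := truncated n (k + N0).
have mF A : measurable_fun setT (F A).
  apply/measurable_EFinP/measurable_funX; apply: measurable_funB.
    exact: (measurableT_comp (measurable_travel_sample A) measurable_fst).
  exact: (measurableT_comp (measurable_travel_sample A) measurable_snd).
have F0 A w : 0 <= F A w by rewrite lee_fin sqr_ge0.
have FN k : \int[P \x P]_w F (AN k) w <= (variance_bound n)%:E.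
  have ANa : AN k (map (axis_edge d0) (iota 0 n)).
    by split; [exact: axis_in_paths|apply: N0P; rewrite leq_addl].
  apply: (@double_variance_finite (AN k) (axis_point d n)
    [seq q i | i <- iota 0 (k + N0)]) => //.
  - by move=> s [].
  - by exists (map (axis_edge d0) (iota 0 n)).
  - by move=> s [].
  - exact: integral_travel_axis.
have Fcv w : F (AN k) w @[k --> \oo] --> F (paths 0%R (axis_point d n)) w.
  have cv x : travel (AN k) x @[k --> \oo] --> travel (paths 0%R (axis_point d n)) x.
    apply: first_passage_exhaust.
    - exact: ptimes_ge0.
    - by exists (map (axis_edge d0) (iota 0 n)); exact: axis_in_paths.
    - by move=> k s [].
    - move=> s ps; have [N1 N1P] := first_subset s; exists N1 => k k1.
      by split=> //; apply: N1P; rewrite (leq_trans k1)// leq_addr.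
  apply: cvg_EFin; first exact: nearW.
  rewrite /comp /F /=; under eq_fun do rewrite expr2; rewrite expr2.
  by apply: cvgM; apply: cvgB; exact: cv.
have -> : \int[P \x P]_w F (paths 0%R (axis_point d n)) w =
    \int[P \x P]_w limn_einf (fun k => F (AN k) w).
  apply: eq_integral => w _; have [-> _] := cvg_limn_einf_sup (Fcv w).
  by [].
apply: (le_trans (fatou _ _ _ _)) => //.
rewrite limn_einf_lim; apply: lime_le; first exact: is_cvg_einfs.
apply: nearW => k; apply: le_trans (FN k).
by apply: ereal_inf_lbound; exists k => //=.
Qed.

(** The passage time from the origin to [(n, 0, ..., 0)]. *)
Definition origin_time n (w : T) : R :=
  travel (paths 0%R (axis_point d n)) (sample w).

(** The mean of [origin_time n]. *)
Definition mean_time n : R := fine (\int[P]_w (origin_time n w)%:E).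

Lemma measurable_origin_time n : measurable_fun setT (origin_time n).
Proof. exact: measurable_travel_sample. Qed.

Lemma origin_time_ge0 n w : (0 <= origin_time n w)%R.
Proof. exact: travel_ge0. Qed.

Lemma mean_timeE n : \int[P]_w (origin_time n w)%:E = (mean_time n)%:E.
Proof.
rewrite /mean_time fineK// ge0_fin_numE; last first.
  by apply: integral_ge0 => w _; rewrite lee_fin origin_time_ge0.
apply: le_lt_trans (ltry (n%:R * (1 + M))%R).
by apply: integral_travel_axis; exact: axis_in_paths.
Qed.

Lemma mean_time_ge0 n : (0 <= mean_time n)%R.
Proof. by rewrite fine_ge0// integral_ge0// => w _; rewrite lee_fin origin_time_ge0. Qed.

Lemma mean_time_le n : (mean_time n <= (1 + M) * n%:R)%R.
Proof.
rewrite -lee_fin -mean_timeE mulrC.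
by apply: integral_travel_axis; exact: axis_in_paths.
Qed.

Lemma axis_nonempty k n : paths (axis_point d k) (axis_point d (k + n)) !=set0.
Proof. by exists (map (axis_edge d0) (iota k n)); exact: axis_edges_paths. Qed.

Lemma origin_nonempty n : paths 0%R (axis_point d n) !=set0.
Proof. by exists (map (axis_edge d0) (iota 0 n)); exact: axis_in_paths. Qed.

(** Stationarity: the law of the configuration is invariant under translation. *)
Lemma mean_translate k n :
  \int[P]_w (travel (paths (axis_point d k) (axis_point d (k + n))) (sample w))%:E =
  (mean_time n)%:E.
Proof.
set v := axis_point d k.
have lawY : product_law P (fun e => X (translate v e)) nu.
  split=> [e|s A us mA]; first exact: lawX.1.
  rewrite (_ : mkset _ = [set w | forall e, e \in map (translate v) s ->
      A (translate (- v)%R e) (X e w)]); last first.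
    apply/seteqP; split=> w /= h e.
      by move=> /mapP[f fs ->]; rewrite translateK; exact: h.
    move=> es; have := h (translate v e); rewrite translateK; apply.
    exact: map_f.
  rewrite (lawX.2 _ (fun e => A (translate (- v)%R e))) ?map_inj_uniq//; last exact: translate_inj.
  by rewrite big_map; apply: eq_bigr => e _; rewrite translateK.
rewrite -mean_timeE /origin_time.
have mG : measurable_fun setT
    (fun x => (travel (R:=R) (paths 0%R (axis_point d n)) x)%:E).
  by apply/measurable_EFinP; exact: measurable_travel.
rewrite [RHS](product_law_integral lawX lawY mG); last first.
  by move=> x; rewrite lee_fin travel_ge0.
apply: eq_integral => w _; congr EFin; rewrite /travel; congr fine.
rewrite axis_pointD -/v -[v in paths v]add0r first_passage_translate.
by congr first_passage.
Qed.

Lemma mean_time_subadditive n k : (mean_time (n + k) <= mean_time n + mean_time k)%R.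
Proof.
rewrite -lee_fin EFinD -(mean_translate n k) -!mean_timeE -ge0_integralD//; last 4 first.
- by move=> w _; rewrite lee_fin origin_time_ge0.
- by apply/measurable_EFinP; exact: measurable_origin_time.
- by move=> w _; rewrite lee_fin travel_ge0.
- by apply/measurable_EFinP; exact: measurable_travel_sample.
apply: ge0_le_integral => //.
- by move=> w _; rewrite lee_fin origin_time_ge0.
- by apply/measurable_EFinP; exact: measurable_origin_time.
- apply: emeasurable_funD; apply/measurable_EFinP.
    exact: measurable_origin_time.
  exact: measurable_travel_sample.
move=> w _; have tau0 := ptimes_ge0 (sample w).
have o1 := origin_nonempty (n + k); have o2 := origin_nonempty n.
have o3 := axis_nonempty n k.
rewrite /origin_time /travel -!first_passageE//.
by apply: first_passage_triangle; exact: ptimes_ge0.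
Qed.

(** A path to [(n, 0, ..., 0)] has at least [n] edges, and [excess] has mean at
    most [2]. *)
Lemma mean_time_lower n : (n%:R <= mean_time n / (eps / 2) + 2)%R.
Proof.
have a0 : (0 < eps / 2)%R by rewrite divr_gt0.
have ai0 : (0 <= (eps / 2)^-1)%R by rewrite invr_ge0 ltW.
have mex := measurable_excess eps lawX.
have mt : measurable_fun setT (fun w => ((eps / 2)^-1 * origin_time n w)%:E).
  by apply/measurable_EFinP; apply: measurable_funM => //; exact: measurable_origin_time.
have t0 w : 0 <= ((eps / 2)^-1 * origin_time n w)%:E.
  by rewrite lee_fin mulr_ge0 ?origin_time_ge0.
have : \int[P]_w n%:R%:E <=
    \int[P]_w (((eps / 2)^-1 * origin_time n w)%:E + excess X eps w).
  apply: ge0_le_integral => //.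
    exact: emeasurable_funD.
  move=> w _; have [exw|] := ltP (excess X eps w) +oo; last first.
    by rewrite leye_eq => /eqP ->; rewrite addey ?leey.
  have exE : excess X eps w = (fine (excess X eps w))%:E.
    by rewrite fineK// ge0_fin_numE// excess_ge0.
  rewrite exE -EFinD lee_fin -lerBlDr mulrC ler_pdivlMr// -lee_fin.
  rewrite /origin_time /travel -first_passageE; last 2 first.
  - exact: ptimes_ge0.
  - exact: origin_nonempty.
  apply: le_ereal_inf_tmp => _ [s ps <-]; rewrite lee_fin -ler_pdivlMr// lerBlDr.
  apply: le_trans (path_length_bound eps0 ps exw).
  by rewrite ler_nat (paths_axis_size d0 ps).
rewrite integral_cst//= probability_setT mule1 ge0_integralD//; last first.
  by move=> w _; exact: excess_ge0.
under eq_integral do rewrite EFinM.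
rewrite ge0_integralZl_EFin//; last 2 first.
- by move=> w _; rewrite lee_fin origin_time_ge0.
- by apply/measurable_EFinP; exact: measurable_origin_time.
rewrite mean_timeE -EFinM -lee_fin => /le_trans; apply.
by rewrite EFinD mulrC leeD2l// (integral_excess d0 lawX nu_small).
Qed.

Lemma mean_time_cvg : exists mu : R, (0 < mu)%R /\
  (mean_time n / n%:R)%R @[n --> \oo] --> mu.
Proof.
have [mu cv] := fekete mean_time_ge0 mean_time_le mean_time_subadditive.
exists mu; split=> //.
have a0 : (0 < eps / 2)%R by rewrite divr_gt0.
(* For [n >= 4], [mean_time n >= (eps / 2) * (n - 2) >= (eps / 4) * n]. *)
suff : (eps / 4 <= mu)%R by apply: lt_le_trans; rewrite divr_gt0.
rewrite -(cvg_lim _ cv)//; apply: limr_ge; first by apply/cvg_ex; exists mu.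
near=> n.
have n4 : (4 <= n)%N by near: n; exact: nbhs_infty_ge.
have n0 : (0 < n%:R :> R)%R by rewrite ltr0n (leq_trans _ n4).
rewrite ler_pdivlMr//; have := mean_time_lower n.
rewrite -lerBlDr ler_pdivlMr//; apply: le_trans.
have : (4 <= n%:R :> R)%R by rewrite ler_nat.
move: eps0; nra.
Unshelve. all: by end_near. Qed.

(** The variance of the passage time to [(n, 0, ..., 0)] is at most
    [spread * n]. *)
Definition spread : R := (2 * M * ((1 + M) / (eps / 2) + 3))%R.

Lemma variance_origin_time n : (0 < n)%N ->
  \int[P]_w ((origin_time n w - mean_time n) ^+ 2)%:E <= (spread * n%:R)%:E.
Proof.
move=> n0.
apply: (le_trans (variance_le_double (measurable_origin_time n) (origin_time_ge0 n) (mean_timeE n))).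
apply: (le_trans (double_variance n)).
rewrite lee_fin /variance_bound /spread.
have n1 : (1 <= n%:R :> R)%R by rewrite ler1n.
have a0 : (0 < eps / 2)%R by rewrite divr_gt0.
rewrite -[leRHS]mulrA; apply: ler_wpM2l; first by rewrite mulr_ge0// M_ge0.
rewrite [leRHS]mulrDl -[(n%:R * _ / _)%R]mulrA mulrC lerD2l.
by rewrite ler_peMr.
Qed.

Lemma integral_sqr_ptimes_sum (s : seq (edge d)) :
  \int[P]_w ((\sum_(e <- s) ptimes (sample w) e) ^+ 2)%:E <= ((size s)%:R ^+ 2 * M)%:E.
Proof.
have mp e : measurable_fun setT (fun w => (ptimes (sample w) e ^+ 2)%:E).
  by apply/measurable_EFinP/measurable_funX; exact: measurable_ptimes_sample.
apply: (@le_trans _ _ (\int[P]_w ((size s)%:R%:E * \sum_(e <- s) (ptimes (sample w) e ^+ 2)%:E))).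
  apply: ge0_le_integral => //.
  - by move=> w _; rewrite lee_fin sqr_ge0.
  - apply/measurable_EFinP/measurable_funX/measurable_sum => e.
    exact: measurable_ptimes_sample.
  - by apply: emeasurable_funM => //; exact: emeasurable_sum.
  - by move=> w _; rewrite sumEFin -EFinM lee_fin sqr_sum_le.
rewrite ge0_integralZl_EFin//; last 2 first.
- by move=> w _; apply: sume_ge0 => e _; rewrite lee_fin sqr_ge0.
- exact: emeasurable_sum.
rewrite expr2 -mulrA EFinM lee_wpmul2l ?lee_fin//.
rewrite ge0_integral_sum//; last by move=> e w _; rewrite lee_fin sqr_ge0.
elim: s => [|e s IH]; first by rewrite big_nil mul0r.
rewrite big_cons /= -[(size s).+1]add1n natrD mulrDl mul1r EFinD leeD//.
apply: le_trans (XM e); apply: ge0_le_integral => //.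
- by move=> w _; rewrite lee_fin sqr_ge0.
- by apply/measurable_EFinP/measurable_funX; exact: lawX.1.
move=> w _; rewrite lee_fin /ptimes /sample.
have [h|h] := lerP (X e w) 0%R; last by [].
by rewrite expr0n sqr_ge0.
Qed.

(** Nonnegative variables with summable means tend to zero almost surely, since
    their sum is integrable. *)
Lemma ae_cvg0_of_summable (Y : nat -> T -> R) (c : R) :
  (forall k, measurable_fun setT (Y k)) -> (forall k w, (0 <= Y k w)%R) ->
  (forall k, \int[P]_w (Y k w)%:E <= (c / k.+1%:R ^+ 2)%:E) ->
  {ae P, forall w, Y k w @[k --> \oo] --> (0 : R)%R}.
Proof.
move=> mY Y0 intY.
have c0 : (0 <= c)%R.
  have := intY 0%N; rewrite expr1n divr1 -lee_fin; apply: le_trans.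
  by apply: integral_ge0 => w _; rewrite lee_fin.
have mYE k : measurable_fun setT (fun w => (Y k w)%:E) by exact/measurable_EFinP.
pose S w := \sum_(0 <= k <oo) (Y k w)%:E.
have S0 w : 0 <= S w by apply: nneseries_ge0 => k _ _; rewrite lee_fin.
have mS : measurable_fun setT S.
  by apply: ge0_emeasurable_sum => // k w _ _; rewrite lee_fin.
have intS : \int[P]_w S w <= (c * 2)%:E.
  rewrite integral_nneseries//; last by move=> k w _; rewrite lee_fin.
  apply: lime_le.
    by apply: is_cvg_nneseries => k _ _; apply: integral_ge0 => w _; rewrite lee_fin.
  apply: nearW => n; apply: (@le_trans _ _ (\sum_(0 <= k < n) (c / k.+1%:R ^+ 2)%:E)).
    by apply: lee_sum => k _; exact: intY.
  by rewrite sumEFin lee_fin -mulr_sumr ler_wpM2l// sum_inv_sqr_le.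
have iS : P.-integrable setT S.
  apply/integrableP; split=> //.
  under eq_integral do rewrite gee0_abs//.
  exact: le_lt_trans intS (ltry _).
have := integrable_ae measurableT iS; apply: filterS => w /(_ I) Sfin.
apply: cvg_series_cvg_0; apply: nondecreasing_is_cvgn.
  by apply: nondecreasing_series => k _ _.
exists (fine (S w)) => _ [n _ <-]; rewrite -lee_fin fineK// -sumEFin.
by apply: nneseries_lim_ge => k _; rewrite lee_fin.
Qed.

Lemma origin_time_step a j w :
  (origin_time (a + j) w <= origin_time a w +
     \sum_(i <- iota a j) ptimes (sample w) (axis_edge d0 i))%R.
Proof.
have tau0 := ptimes_ge0 (sample w).
have o1 := origin_nonempty (a + j); have o2 := origin_nonempty a.
rewrite -lee_fin EFinD /origin_time /travel -!first_passageE//.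
apply: le_trans (first_passage_triangle _ (axis_point d a) _ tau0) _.
by rewrite leeD2l// first_passage_axis.
Qed.

(** The passage time of the straight segment from [k ^ 2] to [(k + 1) ^ 2] on
    the first axis. *)
Definition segment_time k w : R :=
  (\sum_(e <- map (axis_edge d0) (iota (k ^ 2) (k.+1 ^ 2 - k ^ 2)))
     ptimes (sample w) e)%R.

Lemma measurable_segment_time k : measurable_fun setT (segment_time k).
Proof. by apply: measurable_sum => e; exact: measurable_ptimes_sample. Qed.

Lemma origin_time_gap w k a j : (k ^ 2 <= a)%N -> (a + j <= k.+1 ^ 2)%N ->
  (origin_time (a + j) w <= origin_time a w + segment_time k w)%R.
Proof.
move=> ka ak; apply: (le_trans (origin_time_step a j w)); rewrite lerD2l.
rewrite /segment_time big_map.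
have -> : (k.+1 ^ 2 - k ^ 2 = (a - k ^ 2) + (j + (k.+1 ^ 2 - (a + j))))%N by lia.
rewrite !iotaD !big_cat/= subnKC// addrCA lerDl.
by rewrite addr_ge0//; apply: sumr_ge0 => i _; exact: ptimes_ge0.
Qed.

Lemma ae_origin_time (mu : R) : (0 < mu)%R ->
  (mean_time n / n%:R)%R @[n --> \oo] --> mu ->
  {ae P, forall w, (origin_time n w / n%:R)%R @[n --> \oo] --> mu}.
Proof.
move=> mu0 mcv.
pose Z k w := (((origin_time (k.+1 ^ 2) w - mean_time (k.+1 ^ 2)) / (k.+1 ^ 2)%:R) ^+ 2)%R.
pose W k w := ((segment_time k.+1 w / (k.+1 ^ 2)%:R) ^+ 2)%R.
have scale (F : T -> R) (c K : R) : measurable_fun setT F ->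
    \int[P]_w (F w ^+ 2)%:E <= K%:E ->
    \int[P]_w ((F w / c) ^+ 2)%:E <= (K / c ^+ 2)%:E.
  move=> mF FK.
  under eq_integral do rewrite exprMn exprVn mulrC EFinM.
  rewrite ge0_integralZl_EFin//; last 3 first.
  - by move=> w _; rewrite lee_fin sqr_ge0.
  - by apply/measurable_EFinP/measurable_funX.
  - by rewrite invr_ge0 sqr_ge0.
  by rewrite mulrC EFinM lee_wpmul2l// lee_fin invr_ge0 sqr_ge0.
have mo n : measurable_fun setT (fun w => origin_time n w - mean_time n)%R.
  by apply: measurable_funB => //; exact: measurable_origin_time.
have Zcv : {ae P, forall w, Z k w @[k --> \oo] --> (0 : R)%R}.
  apply: (ae_cvg0_of_summable (c := spread)).
  - by move=> k; apply/measurable_funX/measurable_funM.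
  - by move=> k w; exact: sqr_ge0.
  move=> k; have := variance_origin_time (n := k.+1 ^ 2).
  rewrite expn_gt0 => /(_ isT) /(scale _ (k.+1 ^ 2)%:R _ (mo _)).
  move=> /le_trans; apply; rewrite lee_fin -natrX.
  set x := _%:R; have x0 : (x != 0)%R by rewrite pnatr_eq0 expn_eq0.
  by rewrite le_eqVlt; apply/orP; left; apply/eqP; field.
have Wcv : {ae P, forall w, W k w @[k --> \oo] --> (0 : R)%R}.
  apply: (ae_cvg0_of_summable (c := (16 * M)%R)).
  - by move=> k; apply/measurable_funX/measurable_funM => //; exact: measurable_segment_time.
  - by move=> k w; exact: sqr_ge0.
  move=> k; have := integral_sqr_ptimes_sum
    (map (axis_edge d0) (iota (k.+1 ^ 2) (k.+2 ^ 2 - k.+1 ^ 2))).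
  move=> /(scale _ (k.+1 ^ 2)%:R _ (measurable_segment_time k.+1)).
  move=> /le_trans; apply; rewrite lee_fin size_map size_iota.
  (* The segment has [2 * k + 3] edges, and [16] is the square of [4]. *)
  have len : (k.+2 ^ 2 - k.+1 ^ 2 <= 4 * k.+1)%N by lia.
  have lenR : ((k.+2 ^ 2 - k.+1 ^ 2)%:R <= 4 * k.+1%:R :> R)%R.
    by rewrite -natrM ler_nat.
  rewrite natrX; set x := k.+1%:R in lenR *.
  have x0 : (0 < x)%R by rewrite ltr0n.
  have -> : (16 * M / x ^+ 2 = (4 * x) ^+ 2 * M / (x ^+ 2) ^+ 2)%R.
    by field; rewrite gt_eqF.
  apply: ler_wpM2r; first by rewrite invr_ge0 sqr_ge0.
  apply: ler_wpM2r; first exact: M_ge0.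
  rewrite ler_pXn2r// nnegrE; first exact: ler0n.
  by apply: mulr_ge0 => //; exact: ltW.
apply: filterS2 Zcv Wcv => w Zw Ww.
apply: (cvg_from_squares (D := fun k => segment_time k w) (ltW mu0)).
- have sq_oo : (fun k => k ^ 2)%N @ \oo --> \oo.
    have kk k : (k <= k ^ 2)%N by case: k => // k; rewrite -mulnn leq_pmulr.
    apply/cvgnyPge => A; near=> k; apply: leq_trans (kk k).
    by near: k; exact: nbhs_infty_ge.
  have h1 : (mean_time (k ^ 2) / (k ^ 2)%:R)%R @[k --> \oo] --> mu.
    exact: (cvg_comp _ _ sq_oo mcv).
  have h2 : ((origin_time (k ^ 2) w - mean_time (k ^ 2)) / (k ^ 2)%:R)%R @[k --> \oo] --> (0 : R)%R.
    by rewrite -cvg_shiftS; apply: cvg_sqr0; exact: Zw.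
  have -> : (fun k => origin_time (k ^ 2) w / (k ^ 2)%:R)%R =
      (fun k => mean_time (k ^ 2) / (k ^ 2)%:R +
        (origin_time (k ^ 2) w - mean_time (k ^ 2)) / (k ^ 2)%:R)%R.
    by apply/funext => k; rewrite -mulrDl addrC subrK.
  by rewrite -[X in _ --> X]addr0; exact: (cvgD h1 h2).
- by rewrite -cvg_shiftS; apply: cvg_sqr0; exact: Ww.
- move=> k n /andP[kn nk]; split.
    by have := @origin_time_gap w k (k ^ 2) (n - k ^ 2) (leqnn _); rewrite subnKC//; apply.
  by have := @origin_time_gap w k n (k.+1 ^ 2 - n) kn; rewrite subnKC//; apply.
Unshelve. all: by end_near. Qed.

(** The mean square splits into the variance, of order [1 / n], and the bias. *)
Lemma mean_square_origin_time (mu : R) :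
  (mean_time n / n%:R)%R @[n --> \oo] --> mu ->
  exists b : nat -> R, b n @[n --> \oo] --> (0 : R)%R /\
  forall n, (0 < n)%N ->
    \int[P]_w ((origin_time n w / n%:R - mu) ^+ 2)%:E <= (b n)%:E.
Proof.
move=> mcv.
exists (fun n => 2 * spread / n%:R + 2 * (mean_time n / n%:R - mu) ^+ 2)%R; split.
  have -> : (0 : R)%R = (2 * spread * 0 + 2 * ((mu - mu) * (mu - mu)))%R by rewrite subrr !mulr0 addr0.
  apply: cvgD.
    apply: cvgM; first exact: cvg_cst.
    by rewrite -cvg_shiftS; exact: cvg_harmonic.
  under eq_fun do rewrite expr2.
  apply: cvgM; first exact: cvg_cst.
  by apply: cvgM; apply: cvgB => //; exact: cvg_cst.
move=> n n0; have nR : (0 < n%:R :> R)%R by rewrite ltr0n.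
have mo : measurable_fun setT (fun w => (origin_time n w - mean_time n) ^+ 2)%R.
  apply: measurable_funX; apply: measurable_funB => //; exact: measurable_origin_time.
apply: (@le_trans _ _ (\int[P]_w (((2 / n%:R ^+ 2) * (origin_time n w - mean_time n) ^+ 2)%:E +
   (2 * (mean_time n / n%:R - mu) ^+ 2)%:E))).
  apply: ge0_le_integral => //.
  - by move=> w _; rewrite lee_fin sqr_ge0.
  - apply/measurable_EFinP/measurable_funX; apply: measurable_funB => //.
    by apply: measurable_funM => //; exact: measurable_origin_time.
  - by apply: emeasurable_funD => //; apply/measurable_EFinP; exact: measurable_funM.
  move=> w _; rewrite -EFinD lee_fin.
  set x := origin_time n w; set m := mean_time n; set k := n%:R in nR *.
  have -> : (2 / k ^+ 2 * (x - m) ^+ 2 = 2 * (x / k - m / k) ^+ 2)%R.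
    by field; rewrite gt_eqF.
  move: (x / k)%R (m / k)%R => {}x {}m.
  have : (0 <= (x - m - (m - mu)) ^+ 2)%R by exact: sqr_ge0.
  nra.
have c0 : (0 <= 2 / n%:R ^+ 2 :> R)%R by rewrite divr_ge0// sqr_ge0.
rewrite ge0_integralD//; last 3 first.
- by move=> w _; rewrite lee_fin mulr_ge0 ?sqr_ge0.
- by apply/measurable_EFinP; exact: measurable_funM.
- by move=> w _; rewrite lee_fin mulr_ge0 ?sqr_ge0.
rewrite [X in _ + X]integral_cst//= probability_setT mule1 EFinD leeD2r//.
under eq_integral do rewrite EFinM.
rewrite ge0_integralZl_EFin//; last 2 first.
- by move=> w _; rewrite lee_fin sqr_ge0.
- exact/measurable_EFinP.
apply: (@le_trans _ _ ((2 / n%:R ^+ 2)%:E * (spread * n%:R)%:E)).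
  by rewrite lee_wpmul2l ?lee_fin// variance_origin_time.
rewrite -EFinM lee_fin le_eqVlt; apply/orP; left; apply/eqP.
by field; rewrite gt_eqF.
Qed.

End Variance.

(** * From the random variables to their laws and norms *)

Section Transfer.
Set Implicit Arguments.
Unset Strict Implicit.
Variables (R : realType) (disp : measure_display) (T : measurableType disp)
  (P : probability T R).

Lemma iid_product_law (J : choiceType) (q : nat -> J) (t : J -> {RV P >-> R}) :
  bijective q -> iid (fun i => t (q i)) ->
  product_law P (fun j => t j : T -> R) (fun A => P (t (q 0%N) @^-1` A)).
Proof.
move=> [q' qK q'K] [ind same]; split=> [j|s A us mA]; first exact: measurable_funPT.
pose L : {fset nat} := [fset x in map q' s]%fset.
have := ind L (fun i => A (q i)) (fun i => mA (q i)).
rewrite (_ : \bigcap_(i in _) _ = [set w | forall j, j \in s -> A j (t j w)]); last first.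
  apply/seteqP; split=> w /= h.
    move=> j js; have := h (q' j); rewrite /= !inE /= q'K; apply.
    by apply/map_f.
  by move=> i /=; rewrite !inE /= => /mapP[j js ->]; rewrite q'K; exact: h.
move=> ->.
have pL : perm_eq L (map q' s).
  apply: uniq_perm; rewrite ?fset_uniq//.
    by rewrite map_inj_uniq//; exact: can_inj q'K.
  by move=> i; rewrite !inE.
rewrite (perm_big _ pL)/= big_map; apply: eq_bigr => j _; rewrite q'K.
by have := same (q' j) 0%N (A j) (mA j); rewrite /distribution /pushforward q'K.
Qed.

(** A bound on the mean square of a real version of [g] bounds its [L^2] norm. *)
Lemma Lnorm2_le (g : T -> \bar R) (h : T -> R) (b : R) :
  measurable_fun setT g -> measurable_fun setT h ->
  {ae P, forall w, g w = (h w)%:E} ->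
  (\int[P]_w ((h w) ^+ 2)%:E <= b%:E)%E ->
  ('N[P]_2%:E[g] <= (Num.sqrt b)%:E)%E.
Proof.
move=> mg mh gh hb.
have b0 : 0 <= b.
  rewrite -lee_fin (le_trans _ hb)//; apply: integral_ge0 => w _.
  by rewrite lee_fin sqr_ge0.
rewrite unlock.
have -> : (\int[P]_w (`|g w| `^ 2) = \int[P]_w ((h w) ^+ 2)%:E)%E.
  apply: ge0_ae_eq_integral => //.
  - apply: (@measurableT_comp _ _ _ _ _ _ (@poweR R ^~ 2)) => //.
      exact: measurable_poweR.
    exact: measurableT_comp.
  - by apply/measurable_EFinP; exact: measurable_funX.
  - by move=> w _; exact: poweR_ge0.
  - by move=> w _; rewrite lee_fin sqr_ge0.
  apply: filterS gh => w -> _.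
  by rewrite abse_EFin poweR_EFin powR_mulrn// real_normK// num_real.
rewrite -powR12_sqrt// -poweR_EFin; apply: gt0_ler_poweR => //.
- by rewrite in_itv /= leey andbT; apply: integral_ge0 => w _; rewrite lee_fin sqr_ge0.
- by rewrite in_itv /= leey andbT lee_fin.
Qed.

End Transfer.

(** * The law of large numbers *)

Theorem corollary1 (R : realType) (disp : measure_display)
    (Omega : measurableType disp) (P : probability Omega R)
    (d : nat) (hd : (2 <= d)%N)
    (q : nat -> edge d) (hq : bijective q)
    (t : edge d -> {RV P >-> R})
    (t_iid : iid (fun i : nat => t (q i)))
    (t_small : ereal_sup (range (fun i : nat => P [set w | t (q i) w < eps]))
                 @[eps --> (0 : R)^'+] --> 0%E)
    (t_moment : (ereal_sup (range (fun i : nat =>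
                   'E_P[(fun w => (t (q i) w ^+ 2)%R)])) < +oo)%E) :
  let Tn := fun (n : nat) (w : Omega) => min_passage_time (fun e => t e w) n in
  let ratio := fun (n : nat) (w : Omega) => (Tn n w * (n%:R^-1)%:E)%E in
  exists mu : R, 0 < mu /\
    cvg_almost_surely P ratio (fun _ => mu%:E) /\
    cvg_in_L2 P ratio (fun _ => mu%:E).
Proof.
move=> Tn ratio.
have d0 : (0 < d)%N by exact: ltnW.
have d0R : 0 < d%:R :> R by rewrite ltr0n.
have lawX := iid_product_law hq t_iid.
set nu := (fun A : set R => _) in lawX.
(* The probability of a cheap edge required by [measure_cheap_path]. *)
set c := (16 * d%:R)^-1 ^+ 2 : R.
have c0 : 0 < c by rewrite exprn_gt0// invr_gt0 mulr_gt0.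
have small_eps (e : R) : 0 < e -> exists2 eps : R, 0 < eps &
    forall i, (P [set w | (t (q i) w < eps)%R] <= e%:E)%E.
  move=> e0.
  have [eps [eps0 epsP]] : exists eps : R, 0 < eps /\
      (ereal_sup (range (fun i : nat => P [set w | (t (q i) w < eps)%R])) < e%:E)%E.
    have near0 : \forall eps \near (0 : R)^'+,
        (ereal_sup (range (fun i : nat => P [set w | (t (q i) w < eps)%R])) < e%:E)%E.
      apply: (t_small [set x | (x < e%:E)%E]).
      by apply: open_ereal_lt'; rewrite lte_fin.
    near (0 : R)^'+ => eps; exists eps; split.
      by near: eps; exact: nbhs_right_gt.
    by near: eps.
  exists eps => // i; apply: le_trans (ltW epsP).
  by apply: ereal_sup_ubound; exists i.
have [eps eps0 epsP] := small_eps c c0.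
have nu_small : (nu [set x | (x < eps)%R] <= ((16 * d%:R)^-1 ^+ 2)%:E)%E by exact: epsP 0%N.
pose S := (ereal_sup (range (fun i : nat => 'E_P[(fun w => (t (q i) w ^+ 2)%R)])))%E.
have tS e : (\int[P]_w ((t e w) ^+ 2)%:E <= S)%E.
  case: hq => q' _ q'K; rewrite -(q'K e); apply: ereal_sup_ubound.
  by exists (q' e) => //; rewrite unlock.
have S0 : (0 <= S)%E.
  apply: le_trans (tS (q 0%N)); apply: integral_ge0 => w _.
  by rewrite lee_fin sqr_ge0.
pose M := fine S.
have SM : S = M%:E by rewrite fineK// ge0_fin_numE.
have XM e : (\int[P]_w ((t e w) ^+ 2)%:E <= M%:E)%E by rewrite -SM.
have [mu [mu0 mcv]] := mean_time_cvg d0 lawX eps0 nu_small XM.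
have aeX := ae_origin_time d0 lawX eps0 nu_small XM hq mu0 mcv.
have [b [b0 bP]] := mean_square_origin_time d0 lawX eps0 nu_small XM hq mcv.
set F := origin_time (fun e => t e : Omega -> R) in aeX bP.
have mF n : measurable_fun setT (F n) by exact: measurable_origin_time lawX n.
have mlt i (a : R) : measurable [set w | (t (q i) w < a)%R].
  rewrite -[X in measurable X]setTI (_ : [set w | _] = t (q i) @^-1` `]-oo, a[%classic).
    by apply: measurable_funPT => //; exact: measurable_itv.
  by apply/seteqP; split=> w /=; rewrite in_itv.
have ae0 : {ae P, forall w, forall i, 0 <= t (q i) w}.
  apply/ae_foralln => i; exists [set w | (t (q i) w < 0)%R]; split.
  - exact: mlt.
  - apply/eqP; rewrite eq_le measure_ge0 andbT.
    apply/lee_addgt0Pr => e e0; rewrite add0e.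
    have [eps' eps'0 epsP'] := small_eps e e0.
    apply: le_trans (epsP' i); apply: le_measure; rewrite ?inE; [exact: mlt|exact: mlt|].
    by move=> w /= h; exact: lt_trans h eps'0.
  - by move=> w /= h; rewrite ltNge; apply/negP.
have aeF : {ae P, forall w, forall n, Tn n w = (F n w)%:E}.
  apply: filterS ae0 => w tw n.
  have tw' e : 0 <= t e w by case: hq => q' _ q'K; rewrite -(q'K e).
  have E : ptimes (sample (fun e => t e) w) = (fun e => t e w).
    by apply/funext => e; rewrite /ptimes /sample max_l.
  by rewrite /F /origin_time /travel E -first_passageE//; exact: origin_nonempty.
have mTn n : measurable_fun setT (Tn n).
  apply: measurable_ereal_inf_countable => s; apply/measurable_EFinP.
  by apply: measurable_sum => e; exact: measurable_funPT.
have mratio n : measurable_fun setT (ratio n).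
  by apply: emeasurable_funM => //; exact: measurable_cst.
have aeR n : {ae P, forall w, ratio n w = (F n w / n%:R)%:E}.
  by apply: filterS aeF => w h; rewrite /ratio h -EFinM.
exists mu; split => //; split; last split.
- rewrite /cvg_almost_surely; apply: filterS2 aeF aeX => w Fw cvw.
  rewrite (_ : (fun n => ratio n w) = (fun n => (F n w / n%:R)%:E)).
    by apply: cvg_EFin; [exact: nearW|exact: cvw].
  by apply/funext => n; rewrite /ratio Fw -EFinM.
- move=> n; split=> //.
  case: n => [|n].
    rewrite (_ : ratio 0%N = cst 0%E) ?Lnorm0//.
    by apply/funext => w; rewrite /ratio invr0 mule0.
  apply: le_lt_trans (ltry (Num.sqrt (2 * b n.+1 + 2 * mu ^+ 2))).
  apply: (@Lnorm2_le _ _ _ _ _ (fun w => F n.+1 w / n.+1%:R)) => //.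
    exact: measurable_funM.
  have msq : measurable_fun setT (fun w => ((F n.+1 w / n.+1%:R - mu) ^+ 2)%:E).
    by apply/measurable_EFinP/measurable_funX/measurable_funB => //; exact: measurable_funM.
  apply: (@le_trans _ _ (\int[P]_w (2%:E * ((F n.+1 w / n.+1%:R - mu) ^+ 2)%:E +
      (2 * mu ^+ 2)%:E))%E).
    apply: ge0_le_integral => //.
    - by move=> w _; rewrite lee_fin sqr_ge0.
    - by apply/measurable_EFinP/measurable_funX; exact: measurable_funM.
    - by apply: emeasurable_funD => //; exact: emeasurable_funM.
    move=> w _; rewrite -EFinM -EFinD lee_fin.
    move: (_ / _) => x; have : 0 <= (x - mu - mu) ^+ 2 by exact: sqr_ge0.
    nra.
  rewrite ge0_integralD//; last 3 first.
  - by move=> w _; rewrite mule_ge0// lee_fin sqr_ge0.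
  - exact: emeasurable_funM.
  - by move=> w _; rewrite lee_fin mulr_ge0 ?sqr_ge0.
  rewrite [X in (_ + X)%E]integral_cst//= probability_setT mule1 [leRHS]EFinD leeD2r//.
  rewrite ge0_integralZl_EFin//; last by move=> w _; rewrite lee_fin sqr_ge0.
  by rewrite EFinM lee_wpmul2l// bP.
- have bound n : (0 < n)%N ->
    ('N[P]_2%:E[ratio n \- (fun=> mu%:E)] <= (Num.sqrt (b n))%:E)%E.
    move=> n0.
    apply: (@Lnorm2_le _ _ _ _ _ (fun w => F n w / n%:R - mu)) => //.
    + by apply: emeasurable_funB.
    + by apply: measurable_funB => //; exact: measurable_funM.
    + by apply: filterS (aeR n) => w /= ->.
    + exact: bP.
  apply: (@squeeze_cvge _ _ _ _ (fun=> 0%E) _ (fun n => (Num.sqrt (b n))%:E)).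
  + near=> n; rewrite Lnorm_ge0/=; apply: bound.
    by near: n; exact: nbhs_infty_gt.
  + exact: cvg_cst.
  + rewrite -[X in _ --> X%:E]sqrtr0; apply: cvg_EFin; first exact: nearW.
    by apply: (continuous_cvg _ _ b0); exact: sqrt_continuous.
Unshelve. all: by end_near. Qed.
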